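(* Let $f:\mathbf{2}^*\to\mathbb{N}$ be a partial function. \begin{enumerate} \item $f$ is the restriction to a $\Pi^0_2$ set of a partial recursive function if and only if it is of the form $f=Church\circ\Phi$ for some computable functional $\Phi:\mathbf{2}^*\to(\mathbb{N}\to\mathbb{N})^{(\mathbb{N}\to\mathbb{N})}$. \item (a) $f$ is the $\max$ of a total recursive sequence of functions if and only if it is of the form $p\mapsto card(W^{\mathbb{N}}_{\varphi(p)})$ for some total recursive $\varphi:\mathbf{2}^*\to\mathbf{2}^*$. (b) The analogous characterization of the $\max$ of total $\emptyset'$-recursive sequences by functions $p\mapsto index(W^{\mathbb{N}^2}_{\varphi(p)})$ holds up to $1$, i.e.: if $f$ is the $\max$ of a total $\emptyset'$-recursive sequence of functions, then $f+1$ is of the form $p\mapsto index(W^{\mathbb{N}^2}_{\varphi(p)})$ for some total recursive $\varphi:\mathbf{2}^*\to\mathbf{2}^*$; and if $f$ is of the form $p\mapsto index(W^{\mathbb{N}^2}_{\varphi(p)})$ for some total recursive $\varphi:\mathbf 2^*\to\mathbf 2^*$, then $f$ is the $\max$ of a total $\emptyset'$-recursive sequence of functions. \item $f$ is partial $\emptyset'$-recursive (resp. partial $\emptyset''$-recursive) if and only if it is of the form $$p\mapsto card(W^{\mathbb{N}}_{\varphi_1(p)})-card(W^{\mathbb{N}}_{\varphi_2(p)})\quad\text{(resp. } p\mapsto index(W^{\mathbb{N}^2}_{\varphi_1(p)})-index(W^{\mathbb{N}^2}_{\varphi_2(p)})\text{)}$$ for some total recursive $\varphi_1,\varphi_2:\mathbf{2}^*\to\mathbf{2}^*$.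 \end{enumerate}
   Context: $\mathbf 2^*$ is the set of finite binary words; $X\to Y$ denotes the class of partial functions from $X$ to $Y$, and $Y^X$ the set of total functions. Equality of partial functions means same domain and same values; a difference is defined iff both terms are. $\emptyset',\emptyset''$ are the first and second Turing jumps of $\emptyset$. $f$ is the max of a total recursive (resp. total $\emptyset'$-recursive) sequence of functions if $f(p)=\max\{h(p,t):t\in\mathbb N\}$ for some total recursive (resp. $\emptyset'$-recursive) $h:\mathbf 2^*\times\mathbb N\to\mathbb N$, where the max of an infinite set is undefined. $W^{\mathbb N}_q$ (resp. $W^{\mathbb N^2}_q$) is the r.e. subset of $\mathbb N$ (resp. $\mathbb N^2$) with code $q\in\mathbf 2^*$ in a fixed acceptable enumeration (domains of the functions in a standard enumeration of partial recursive functions, i.e. a partial recursive one with the s-m-n property). $card(Y)$ is the number of elements of $Y$ if $Y$ is finite, undefined otherwise. $index(\rho)$ is the number of equivalence classes if $\rho\subseteq\mathbb N^2$ is an equivalence relation on some subset of $\mathbb N$ with finitely many classes, undefined otherwise. $Church:(\mathbb N\to\mathbb N)^{(\mathbb N\to\mathbb N)}\to\mathbb N$ is the partial functional with $Church(\Psi)=n$ if $\Psi$ is the iterator $g\mapsto g^{(n)}$ on all partial $g:\mathbb N\to\mathbb N$ (where $g^{(0)}=Id$, $g^{(n+1)}=g^{(n)}\circ g$), and undefined if there is no such $n$. A functional $\Phi:\mathbf 2^*\to(\mathbb N\to\mathbb N)^{(\mathbb N\to\mathbb N)}$ is computable if there is an oracle Turing machine which, given input $(p,x)\in\mathbf 2^*\times\mathbb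 N$ and a partial function $g:\mathbb N\to\mathbb N$ as oracle (it may query values $g(q)$, and gets stuck forever if it queries a $q$ at which $g$ is undefined), computes $\Phi(p)(g)(x)$, being divergent exactly when this is undefined. *)

(* Defs.v *)
From mathcomp Require Import all_boot all_order all_algebra.
From mathcomp Require Import all_classical.

Set Implicit Arguments.
Unset Strict Implicit.
Unset Printing Implicit Defensive.

Local Open Scope classical_set_scope.
Local Open Scope card_scope.

(* Partial functions [X -> Y] are total functions [X -> option Y]; since the
   development is classical, every functional relation is of this form. *)
Definition pfun (X Y : Type) := X -> option Y.

Definition word := seq bool.

(* [the_nat P] is the partial description operator "the n such that P n,
   undefined if there is none"; it is only applied to sets [P] with at most
   one element. *)
Definition the_nat (P : set nat) : option nat := xget None [set Some n | n in P].

(* Turing machines are deterministic, with any finite number of two-way infinite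
   tapes over the alphabet {blank, 0, 1}, and with partial functions on nat as
   oracles.  Natural numbers are written in unary. *)

Definition symbol := option bool. (* [None] is the blank *)

Inductive move := MoveL | Stay | MoveR.

(* [(l, r)]: [l] lists the cells to the left of the head, nearest first; [r]
   lists the cells from the scanned one rightwards; all others are blank. *)
Definition tape := (seq symbol * seq symbol)%type.

Definition scan (t : tape) : symbol := head None t.2.

Definition act (t : tape) (a : symbol * move) : tape :=
  let: (l, r) := (t.1, a.1 :: behead t.2) in
  match a.2 with
  | MoveL => (behead l, head None l :: r)
  | Stay => (l, r)
  | MoveR => (a.1 :: l, behead r)
  end.

Definition tape_of (w : word) : tape := ([::], [seq Some b | b <- w]).

Definition unary (n : nat) : word := nseq n true.

(* Every tape denotes a number (the length of the block of 1's starting at the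
   head) and a word (the block of nonblank symbols starting at the head), so a
   machine that halts always has an output. *)
Definition read_nat (t : tape) : nat := find (fun s => s != Some true) t.2.
Definition read_word (t : tape) : word := pmap id (take (index None t.2) t.2).

(* [load x] lists the words initially written on tapes 0, 1, ... *)
Class input (X : Type) := load : X -> seq word.
#[global] Instance input_word : input word := fun w => [:: w].
#[global] Instance input_nat : input nat := fun n => [:: unary n].
#[global] Instance input_prod (X Y : Type) (iX : input X) (iY : input Y) :
  input (X * Y) := fun xy => load xy.1 ++ load xy.2.

Class output (Y : Type) := unload : tape -> Y.
#[global] Instance output_word : output word := read_word.
#[global] Instance output_nat : output nat := read_nat.

Inductive instr (k : nat) (Q : Type) :=
| Halt
| Query of Q
| Act of ({ffun 'I_k -> symbol} -> Q * {ffun 'I_k -> symbol * move}).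

Record otm := OTM {
  ntapes : nat;
  state : finType;
  start : state;
  query_tape : 'I_ntapes;
  output_tape : 'I_ntapes;
  prog : state -> instr ntapes state }.

Definition config (M : otm) := (state M * {ffun 'I_(ntapes M) -> tape})%type.

Definition init (M : otm) (ws : seq word) : config M :=
  (start M, [ffun i : 'I_(ntapes M) => tape_of (nth [::] ws i)]).

Definition halted (M : otm) (c : config M) : bool :=
  if prog c.1 is Halt then true else false.

(* A query replaces the number n on the query tape by the value g n; if g n is
   undefined there is no next configuration, and the machine never halts. *)
Definition step (M : otm) (g : pfun nat nat) (c : config M) : option (config M) :=
  match prog c.1 with
  | Halt => None
  | Query q =>
      omap (fun m => (q, [ffun i => if i == query_tape M
                                    then tape_of (unary m) else c.2 i]))
           (g (read_nat (c.2 (query_tape M))))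
  | Act d =>
      let: (q, a) := d [ffun i => scan (c.2 i)] in
      Some (q, [ffun i => act (c.2 i) (a i)])
  end.

Definition outputs (X Y : Type) (iX : input X) (oY : output Y)
    (M : otm) (g : pfun nat nat) (x : X) (y : Y) : Prop :=
  exists (t : nat) (c : config M),
    [/\ iter t (obind (step g)) (Some (init M (load x))) = Some c,
        halted c & unload (c.2 (output_tape M)) = y].
Arguments outputs {X Y iX oY} M g x y.

Definition char_fun (A : set nat) : pfun nat nat :=
  fun n => Some (nat_of_bool `[< A n >]).

Definition partial_recursive_in (A : set nat) (X Y : Type)
    (iX : input X) (oY : output Y) (F : pfun X Y) : Prop :=
  exists M : otm, forall x y, F x = Some y <-> outputs M (char_fun A) x y.
Arguments partial_recursive_in A {X Y iX oY} F.

Definition total_recursive_in (A : set nat) (X Y : Type)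
    (iX : input X) (oY : output Y) (F : X -> Y) : Prop :=
  partial_recursive_in A (fun x => Some (F x)).
Arguments total_recursive_in A {X Y iX oY} F.

(* An oracle for the empty set answers 0 to every query, hence is useless. *)
Notation partial_recursive := (partial_recursive_in set0).
Notation total_recursive := (total_recursive_in set0).

(* [U (i, x)] is the value at [x] of the function with code [i].  The s-m-n
   function is recursive, not merely [A]-recursive.  With [psi] independent of
   [i] one sees that all partial [A]-recursive functions are enumerated. *)
Definition acceptable (A : set nat) (I X : Type)
    (iI : input I) (oI : output I) (iX : input X) (U : pfun (I * X) nat) : Prop :=
  partial_recursive_in A U /\
  forall psi : pfun (I * X) nat, partial_recursive_in A psi ->
    exists s : I -> I, total_recursive s /\
      forall i x, psi (i, x) = U (s i, x).
Arguments acceptable A {I X iI oI iX} U.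

Definition W (I X : Type) (U : pfun (I * X) nat) (i : I) : set X :=
  [set x | U (i, x) <> None].

(* As usual the jump depends on the chosen acceptable enumeration of the
   partial [A]-recursive functions, so "being a jump of [A]" is a relation. *)
Definition is_jump (A A' : set nat) : Prop :=
  exists2 U : pfun (nat * nat) nat, acceptable A U & A' = [set e | W U e e].

Definition Pi02 (P : set word) : Prop :=
  exists2 R : word * nat * nat -> nat, total_recursive R &
    forall p, P p <-> forall m, exists n, R (p, m, n) = 1.

Definition prestrict (X Y : Type) (F : pfun X Y) (P : set X) : pfun X Y :=
  fun x => if `[< P x >] then F x else None.

Definition functional := pfun nat nat -> pfun nat nat.

Definition computable_functional (Phi : word -> functional) : Prop :=
  exists M : otm, forall p g x y,
    Phi p g x = Some y <-> outputs M g (p, x) y.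

Fixpoint iterate (n : nat) (g : pfun nat nat) : pfun nat nat :=
  if n is n'.+1 then fun x => obind (iterate n' g) (g x) else fun x => Some x.

Definition Church (Psi : functional) : option nat :=
  the_nat [set n | forall g x, Psi g x = iterate n g x].

Definition pcard (T : Type) (Y : set T) : option nat :=
  the_nat [set n | Y #= `I_n].

Definition equivalence_on (D : set nat) (rho : set (nat * nat)) : Prop :=
  [/\ forall x y, rho (x, y) -> D x /\ D y,
      forall x, D x -> rho (x, x),
      forall x y, rho (x, y) -> rho (y, x) &
      forall x y z, rho (x, y) -> rho (y, z) -> rho (x, z)].

Definition classes (D : set nat) (rho : set (nat * nat)) : set (set nat) :=
  [set [set y | rho (x, y)] | x in D].

(* The empty relation is an equivalence relation on the empty set, of index 0. *)
Definition pindex (rho : set (nat * nat)) : option nat :=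
  the_nat [set n | exists2 D, equivalence_on D rho & classes D rho #= `I_n].

Definition pmax (h : nat -> nat) : option nat :=
  the_nat [set m | (exists t, h t = m) /\ forall t, h t <= m].

Definition max_of_recursive_in (A : set nat) (f : pfun word nat) : Prop :=
  exists2 h : word * nat -> nat, total_recursive_in A h &
    forall p, f p = pmax (fun t => h (p, t)).

(* The difference is taken in Z, so that it is defined iff both terms are. *)
Definition pdiff (a b : option nat) : option int :=
  match a, b with
  | Some m, Some n => Some (m%:Z - n%:Z)%R
  | _, _ => None
  end.

(* Main.v *)
(* Turing machines are compared with programs on word-valued registers: a tape
   whose nonblank block at the head is [w] is a register holding [w], whatever
   lies elsewhere, so programs compile to machines, and conversely the steps of
   a machine are simulated by a program.  Every partial recursive function is
   therefore the search of a value in a total recursive sequence, and only total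
   functions have to be manipulated.

   1. An iterator is determined by its value at the successor function, which
   gives a partial recursive [F]; by continuity, being an iterator is a Pi02
   condition on finite oracles.  Conversely, let the functional check the first
   [x] instances of the Pi02 condition before it iterates at [x].
   2. The cardinal of an r.e. set is the max of the cardinals of its finite
   approximations, and a max is the cardinal of [{x | exists t, x < h (p, t)}].
   For the index, the jump decides the relation; conversely that set is Sigma02,
   and the codes of pairs (element, witness) support an r.e. relation in which
   only the least true witnesses keep a class apart from a common rejected class,
   whence the shift by 1.
   3. A function recursive in the jump is the limit of guesses revised finitely
   often exactly where it is defined.  A counter that increases by more than the
   guess at each revision, and the sum of this counter and of the guess, are two
   increasing sequences whose maxima differ by the value. *)

Require Import Defs.
From mathcomp Require Import all_boot all_order all_algebra.
From mathcomp Require Import all_classical.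
From mathcomp Require Import zify.

Set Implicit Arguments.
Unset Strict Implicit.
Unset Printing Implicit Defensive.
Generalizable Variables X Y Z A.

(** * Register programs and their compilation *)

(** The shift by 1 comes from the fact that an r.e. relation can merge classes but never take an
    element out of its domain: discarded elements have to share a class, and this class must exist
    even when nothing is discarded. Some shift is unavoidable: index 0 means that an r.e. set is
    empty, a Pi01 condition, while the vanishing of a sequence recursive in the first jump is a Pi02
    condition, complete in general.

    Functionals are where partiality of the oracle matters, since a query outside its domain blocks
    the machine. Programs have a big-step semantics in which blocking and looping are both the
    absence of a derivation. Correctness for a partial function then has two halves: termination
    with the right value where there is one, and existence of a value whenever an execution is
    given. Subprograms that compute recursive functions must not be blocked by the oracle, so their
    queries, to which the empty oracle answers 0, are erased by [strip].

    The third part is proved once, for a set [A] and a jump [A'] of it, and used for the first two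
    jumps. *)

Definition regs := nat -> word.

Definition upd (r : regs) (i : nat) (w : word) : regs :=
  fun j => if j == i then w else r j.

Inductive cmd :=
| Push of nat & bool
| Pop of nat
| Clear of nat
| Ask
| Seq of cmd & cmd
| If of nat & pred symbol & cmd & cmd
| While of nat & pred symbol & cmd.

(** The number that a register presents to the oracle: the counterpart of [read_nat], so words other
    than blocks of 1's denote numbers as well. *)
Definition lead (w : word) : nat := find (fun b => ~~ b) w.

Inductive exec (g : pfun nat nat) : cmd -> regs -> regs -> Prop :=
| EPush i b r : exec g (Push i b) r (upd r i (b :: r i))
| EPop i r : exec g (Pop i) r (upd r i (behead (r i)))
| EClear i r : exec g (Clear i) r (upd r i [::])
| EAsk r m : g (lead (r 0)) = Some m -> exec g Ask r (upd r 0 (unary m))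
| ESeq p q r r1 r2 : exec g p r r1 -> exec g q r1 r2 -> exec g (Seq p q) r r2
| EIfT i (c : pred symbol) p q r r1 : c (ohead (r i)) -> exec g p r r1 -> exec g (If i c p q) r r1
| EIfF i (c : pred symbol) p q r r1 :
    ~~ c (ohead (r i)) -> exec g q r r1 -> exec g (If i c p q) r r1
| EWhileT i (c : pred symbol) p r r1 r2 : c (ohead (r i)) -> exec g p r r1 ->
    exec g (While i c p) r1 r2 -> exec g (While i c p) r r2
| EWhileF i (c : pred symbol) p r : ~~ c (ohead (r i)) -> exec g (While i c p) r r.

Lemma exec_det g p r r1 r2 : exec g p r r1 -> exec g p r r2 -> r1 = r2.
Proof.
move=> H; elim: H r2 => {p r r1}.
- by move=> i b r r2 H; inversion H.
- by move=> i r r2 H; inversion H.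
- by move=> i r r2 H; inversion H.
- by move=> r m gm r2 H; inversion H as [| | |? m' gm'| | | | |]; subst; congruence.
- move=> p q r r1 r2 _ IH1 _ IH2 r3 H.
  inversion H as [| | | |? ? ? s ? H1 H2| | | |]; subst.
  by apply: IH2; rewrite (IH1 _ H1).
- move=> i c p q r r1 cr _ IH r2 H; inversion H; subst; first exact: IH.
  by have /negP[] : ~~ c (ohead (r i)) by [].
- move=> i c p q r r1 cr _ IH r2 H; inversion H; subst; last exact: IH.
  by have /negP[] := cr.
- move=> i c p r r1 r2 cr _ IH1 _ IH2 r3 H.
  inversion H as [| | | | | | |? ? ? ? s ? _ H1 H2|]; subst.
    by apply: IH2; rewrite (IH1 _ H1).
  by have /negP[] : ~~ c (ohead (r3 i)) by [].
- move=> i c p r cr r2 H; inversion H; subst => //.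
  by have /negP[] := cr.
Qed.

Fixpoint width (p : cmd) : nat :=
  match p with
  | Push i _ | Pop i | Clear i => i
  | Ask => 0
  | Seq p q => maxn (width p) (width q)
  | If i _ p q => maxn i (maxn (width p) (width q))
  | While i _ p => maxn i (width p)
  end.

(* A control-flow graph with one entry and one exit, the latter being [None]. *)
Record frag (k : nat) := Frag {
  fstate : finType;
  fentry : fstate;
  fcode : fstate -> instr k (option fstate) }.

Definition imap k Q Q' (h : Q -> Q') (c : instr k Q) : instr k Q' :=
  match c with
  | Halt => Halt k Q'
  | Query q => Query k (h q)
  | Act d => Act (fun s => let: (q, a) := d s in (h q, a))
  end.

Lemma iter_None T (f : T -> option T) n : iter n (obind f) None = None.
Proof. by elim: n => //= n ->. Qed.

Section Compile.
Variable k : nat.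
Let tapes := {ffun 'I_k.+1 -> tape}.
Let frag := frag k.+1.

Definition move_on (i : nat) (s : symbol -> symbol * move)
    (v : {ffun 'I_k.+1 -> symbol}) : {ffun 'I_k.+1 -> symbol * move} :=
  [ffun j => if j == inord i then s (v j) else (v j, Stay)].

Definition frag1 (c : instr k.+1 (option unit)) : frag :=
  @Frag k.+1 unit tt (fun _ => c).

(* Moving left exposes an arbitrary symbol, which is then overwritten. *)
Definition push_frag i b : frag :=
  @Frag k.+1 bool false (fun second => Act (fun v =>
    if second then (None, move_on i (fun _ => (Some b, Stay)) v)
    else (Some true, move_on i (fun s => (s, MoveL)) v))).

(** On a blank the head stays: the empty register must remain empty, whereas the next cell may hold
    remnants of earlier contents. *)
Definition pop_frag i : frag :=
  frag1 (Act (fun v => (None,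
    move_on i (fun s => (s, if s is None then Stay else MoveR)) v))).

Definition clear_frag i : frag :=
  frag1 (Act (fun v => (None, move_on i (fun _ => (None, Stay)) v))).

Definition seq_frag (C D : frag) : frag :=
  @Frag k.+1 (fstate C + fstate D)%type (inl (fentry C)) (fun s =>
    match s with
    | inl s => imap (fun q => Some (if q is Some q then inl q
                                    else inr (fentry D))) (fcode s)
    | inr s => imap (omap inr) (fcode s)
    end).

Definition if_frag i (c : pred symbol) (C D : frag) : frag :=
  @Frag k.+1 (option (fstate C + fstate D)) None (fun s =>
    match s with
    | None => Act (fun v =>
        (Some (Some (if c (v (inord i)) then inl (fentry C)
                     else inr (fentry D))), [ffun j => (v j, Stay)]))
    | Some (inl s) => imap (omap (Some \o inl)) (fcode s)
    | Some (inr s) => imap (omap (Some \o inr)) (fcode s)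
    end).

Definition while_frag i (c : pred symbol) (C : frag) : frag :=
  @Frag k.+1 (option (fstate C)) None (fun s =>
    match s with
    | None => Act (fun v =>
        (if c (v (inord i)) then Some (Some (fentry C)) else None,
         [ffun j => (v j, Stay)]))
    | Some s => imap (@Some _) (fcode s)
    end).

Fixpoint compile (p : cmd) : frag :=
  match p with
  | Push i b => push_frag i b
  | Pop i => pop_frag i
  | Clear i => clear_frag i
  | Ask => frag1 (Query _ None)
  | Seq p q => seq_frag (compile p) (compile q)
  | If i c p q => if_frag i c (compile p) (compile q)
  | While i c p => while_frag i c (compile p)
  end.

Definition istep (g : pfun nat nat) Q (c : instr k.+1 Q) (t : tapes) :
    option (Q * tapes) :=
  match c with
  | Halt => None
  | Query q => omap (fun m => (q, [ffun i => if i == ord0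
                                   then tape_of (unary m) else t i]))
                 (g (read_nat (t ord0)))
  | Act d => let: (q, a) := d [ffun i => scan (t i)] in
             Some (q, [ffun i => act (t i) (a i)])
  end.

Lemma istep_map g Q Q' (h : Q -> Q') c t :
  istep g (imap h c) t = omap (fun x => (h x.1, x.2)) (istep g c t).
Proof.
case: c => [|q|d] //=; first by case: (g _).
by case: (d _).
Qed.

Inductive runs (g : pfun nat nat) (C : frag) : fstate C -> tapes -> tapes -> Prop :=
| runs_exit s t t1 : istep g (fcode s) t = Some (None, t1) -> runs g s t t1
| runs_next s t s1 t1 t2 : istep g (fcode s) t = Some (Some s1, t1) ->
    runs g s1 t1 t2 -> runs g s t t2.

Lemma runs_det g (C : frag) (s : fstate C) t t1 t2 :
  runs g s t t1 -> runs g s t t2 -> t1 = t2.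
Proof.
move=> H; elim: H t2 => {s t t1} [s t t1 e|s t s1 t1 t2 e _ IH] t3 H.
  by inversion H; subst; congruence.
inversion H as [|? ? s' t' ? e']; subst; first congruence.
by apply: IH; move: e'; rewrite e => -[-> ->].
Qed.

Lemma runs_step g (C : frag) (s : fstate C) t t1 :
  runs g s t t1 -> istep g (fcode s) t <> None.
Proof. by case=> {s t t1} [s t t1 ->|s t s1 t1 t2 ->]. Qed.

(** Only the block at the head counts, which allows a register to be cleared by writing a single
    blank. *)
Definition repr (t : tapes) (r : regs) : Prop :=
  forall i, i <= k -> read_word (t (inord i)) = r i.

Lemma read_word_cons l s r :
  read_word (l, s :: r) = if s is Some b then b :: read_word (l, r) else [::].
Proof. by case: s. Qed.

Lemma scanE t : scan t = ohead (read_word t).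
Proof. by case: t => l [|[b|] r]. Qed.

Lemma read_natE t : read_nat t = lead (read_word t).
Proof.
case: t => l r; elim: r => //= s r.
rewrite /read_nat /lead read_word_cons; case: s => [b|] //= ->.
by case: b.
Qed.

Lemma read_tape_of w : read_word (tape_of w) = w.
Proof.
by rewrite /tape_of; elim: w => //= b w IH; rewrite read_word_cons IH.
Qed.

Lemma act_stay t : read_word (act t (scan t, Stay)) = read_word t.
Proof. by case: t => l [|[b|] r]. Qed.

Lemma ohead_repr t r i : i <= k -> repr t r ->
  [ffun j => scan (t j)] (inord i) = ohead (r i).
Proof. by move=> ik tr; rewrite ffunE scanE tr. Qed.

Lemma repr_upd (t t' : tapes) r i w : i <= k -> repr t r ->
    read_word (t' (inord i)) = w ->
    (forall j, j != inord i -> read_word (t' j) = read_word (t j)) ->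
  repr t' (upd r i w).
Proof.
move=> ik tr tw tn j jk; rewrite /upd; case: eqP => [->//|/eqP ji].
rewrite tn ?tr //; apply: contra ji => /eqP/(congr1 val)/=.
by rewrite !inordK ?ltnS // => ->.
Qed.

Lemma repr_stay t r : repr t r ->
  repr [ffun i => act (t i) ([ffun j => ([ffun j => scan (t j)] j, Stay)] i)] r.
Proof. by move=> tr i ik; rewrite !ffunE act_stay tr. Qed.

Lemma runs_seq g C D s t t2 : @runs g (seq_frag C D) (inl s) t t2 <->
  exists2 t1, runs g s t t1 & runs g (fentry D) t1 t2.
Proof.
have Dr s' t' t'' : @runs g (seq_frag C D) (inr s') t' t'' -> runs g s' t' t''.
  move eqx : (inr s' : fstate (seq_frag C D)) => x H.
  elim: H s' eqx => {t' t'' x} [x t' t1|x t' x1 t1 t''] e.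
    move=> s' eqx; move: e; rewrite -eqx istep_map.
    by case E: (istep _ _ _) => [[[q|] u]|] //= [<-]; apply: runs_exit.
  move=> _ IH s' eqx; move: e; rewrite -eqx istep_map.
  case E: (istep _ _ _) => [[[q|] u]|] //= [e1 e2]; subst.
  by apply: runs_next E _; apply: IH.
have rD s' t' t'' : runs g s' t' t'' -> @runs g (seq_frag C D) (inr s') t' t''.
  elim=> {s' t' t''} [s' t' t1 e|s' t' s1 t1 t'' e _ IH].
    by apply: runs_exit; rewrite istep_map e.
  by apply: runs_next IH; rewrite istep_map e.
split=> [|[t1 H1 /rD H2]].
  move eqx : (inl s : fstate (seq_frag C D)) => x H.
  elim: H s eqx => {t t2 x} [x t t1|x t x1 t1 t2] e.
    move=> s' eqx; move: e; rewrite -eqx istep_map.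
    by case E: (istep _ _ _) => [[[q|] u]|].
  move=> H IH s' eqx; move: e; rewrite -eqx istep_map.
  case E: (istep _ _ _) => [[[q|] u]|] //= [e1 e2]; subst.
    have [t3 H3 H4] := IH _ erefl.
    by exists t3 => //; apply: runs_next E _.
  by exists t1; [apply: runs_exit | apply: Dr].
elim: H1 H2 => {s t t1} [s t t1 e H2|s t s1 t1 t3 e _ IH H2].
  by apply: runs_next H2; rewrite istep_map e.
by apply: runs_next (IH H2); rewrite istep_map e.
Qed.

Lemma runs_if g i c C D t t2 : @runs g (if_frag i c C D) None t t2 <->
  let t1 := [ffun i => act (t i) ([ffun j => ([ffun j => scan (t j)] j, Stay)] i)] in
  if c ([ffun j => scan (t j)] (inord i)) then runs g (fentry C) t1 t2
  else runs g (fentry D) t1 t2.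
Proof.
have Cr (E : frag) (h : fstate E -> fstate C + fstate D) s' t' t'' :
    (forall s, fcode (Some (h s) : fstate (if_frag i c C D)) =
       imap (omap (Some \o h)) (fcode s)) ->
    @runs g (if_frag i c C D) (Some (h s')) t' t'' <-> runs g s' t' t''.
  move=> hE; split.
    move eqx : (Some (h s') : fstate (if_frag i c C D)) => x H.
    elim: H s' eqx => {t' t'' x} [x t' t1|x t' x1 t1 t''] e.
      move=> s' eqx; move: e; rewrite -eqx hE istep_map.
      by case E1: (istep _ _ _) => [[[q|] u]|] //= [<-]; apply: runs_exit.
    move=> _ IH s' eqx; move: e; rewrite -eqx hE istep_map.
    case E1: (istep _ _ _) => [[[q|] u]|] //= [e1 e2]; subst.
    by apply: runs_next E1 _; apply: IH.
  elim=> {s' t' t''} [s' t' t1 e|s' t' s1 t1 t'' e _ IH].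
    by apply: runs_exit; rewrite hE istep_map e.
  by apply: runs_next IH; rewrite hE istep_map e.
split=> [H|/=].
  inversion H as [? ? ? e|? ? s1 t1 ? e H1]; subst; move: e => //= -[e1 e2].
  subst s1 t1; move: H1; case: (c _) => H1.
    by apply/(Cr _ inl).
  by apply/(Cr _ inr).
case E: (c _) => H; apply: (@runs_next _ _ _ _ _ _ _ _); rewrite /= ?E //.
  by apply/(Cr _ inl).
by apply/(Cr _ inr).
Qed.

Lemma compile_exec g p r r1 t : width p <= k -> exec g p r r1 -> repr t r ->
  exists2 t1, runs g (fentry (compile p)) t t1 & repr t1 r1.
Proof.
move=> + H; elim: H t => {p r r1} /=.
- move=> i b r t ik tr.
  eexists; first by apply: runs_next => //=; apply: runs_exit.
  apply: (repr_upd _ tr) => [|/=|j ji]; first by [].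
    rewrite !ffunE eqxx /=; move: (tr _ ik).
    by case: (t _) => l [|[s|] u] //= <-.
  by rewrite !ffunE (negbTE ji) !act_stay.
- move=> i r t ik tr.
  eexists; first by apply: runs_exit.
  apply: (repr_upd _ tr) => [|/=|j ji]; first by [].
    rewrite !ffunE eqxx /=; move: (tr _ ik).
    by case: (t _) => l [|[s|] u] //= <-.
  by rewrite !ffunE (negbTE ji) !act_stay.
- move=> i r t ik tr.
  eexists; first by apply: runs_exit.
  apply: (repr_upd _ tr) => [|/=|j ji]; first by [].
    by rewrite !ffunE eqxx.
  by rewrite !ffunE (negbTE ji) !act_stay.
- move=> r m gm t _ tr.
  have in0 : inord 0 = ord0 :> 'I_k.+1 by apply/val_inj; rewrite /= inordK.
  eexists.
    by apply: runs_exit; rewrite /= read_natE -in0 tr // gm.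
  apply: (repr_upd _ tr) => [|/=|j ji]; first by []; rewrite ffunE in0.
    by rewrite eqxx read_tape_of.
  by rewrite -in0 (negbTE ji).
- move=> p q r r1 r2 _ IH1 _ IH2 t; rewrite geq_max => /andP[kp kq] tr.
  have [t1 H1 tr1] := IH1 _ kp tr; have [t2 H2 tr2] := IH2 _ kq tr1.
  by exists t2 => //; apply/runs_seq; exists t1.
- move=> i c p q r r1 cr _ IH t; rewrite !geq_max => /and3P[ki kp kq] tr.
  have [t1 H1 tr1] := IH _ kp (repr_stay tr).
  by exists t1 => //; apply/runs_if; rewrite (ohead_repr ki tr) cr.
- move=> i c p q r r1 cr _ IH t; rewrite !geq_max => /and3P[ki kp kq] tr.
  have [t1 H1 tr1] := IH _ kq (repr_stay tr).
  by exists t1 => //; apply/runs_if; rewrite (ohead_repr ki tr) (negbTE cr).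
- move=> i c p r r1 r2 cr _ IH1 _ IH2 t; rewrite !geq_max => /andP[ki kp] tr.
  have [t1 H1 tr1] := IH1 _ kp (repr_stay tr).
  have kw : maxn i (width p) <= k by rewrite geq_max ki.
  have [t2 H2 tr2] := IH2 _ kw tr1.
  exists t2 => //; apply: runs_next.
    by rewrite /= (ohead_repr ki tr) cr.
  elim: H1 H2 => {tr1} [s u u1 e H2|s u s1 u1 u3 e _ IH H2].
    by apply: runs_next H2; rewrite /= istep_map e.
  by apply: runs_next (IH H2); rewrite /= istep_map e.
- move=> i c p r cr t; rewrite !geq_max => /andP[ki kp] tr.
  eexists; first by apply: runs_exit; rewrite /= (ohead_repr ki tr) (negbTE cr).
  exact: repr_stay.
Qed.

(** This converse makes the absence of a derivation mean that the machine never halts. For atomic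
    commands it follows from [compile_exec] because runs are deterministic; a query without answer
    is excluded by [runs_step]. *)
Lemma exec_compile g p r t t1 : width p <= k -> repr t r ->
  runs g (fentry (compile p)) t t1 -> exists2 r1, exec g p r r1 & repr t1 r1.
Proof.
elim: p r t t1 => [i b|i|i||p IHp q IHq|i c p IHp q IHq|i c p IHp] r t t1.
- move=> kp tr H; have E := EPush g i b r.
  have [t2 H2 ?] := compile_exec kp E tr.
  by eexists; [exact: E | rewrite (runs_det H H2)].
- move=> kp tr H; have E := EPop g i r.
  have [t2 H2 ?] := compile_exec kp E tr.
  by eexists; [exact: E | rewrite (runs_det H H2)].
- move=> kp tr H; have E := EClear g i r.
  have [t2 H2 ?] := compile_exec kp E tr.
  by eexists; [exact: E | rewrite (runs_det H H2)].
- move=> kp tr H.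
  have in0 : inord 0 = ord0 :> 'I_k.+1 by apply/val_inj; rewrite /= inordK.
  case gm: (g (lead (r 0))) => [m|]; last first.
    by have := runs_step H; rewrite /= read_natE -in0 tr // gm.
  have E := @EAsk g r m gm; have [t2 H2 ?] := compile_exec kp E tr.
  by eexists; [exact: E | rewrite (runs_det H H2)].
- rewrite /= geq_max => /andP[kp kq] tr /runs_seq[t2 H1 H2].
  have [r2 E1 tr2] := IHp _ _ _ kp tr H1.
  have [r3 E2 tr3] := IHq _ _ _ kq tr2 H2.
  by exists r3 => //; apply: ESeq E1 E2.
- rewrite /= !geq_max => /and3P[ki kp kq] tr /runs_if /=.
  rewrite (ohead_repr ki tr); case: ifP => cr H.
    have [r2 E1 tr2] := IHp _ _ _ kp (repr_stay tr) H.
    by exists r2 => //; apply: EIfT.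
  have [r2 E1 tr2] := IHq _ _ _ kq (repr_stay tr) H.
  by exists r2 => //; apply: EIfF; rewrite ?cr.
- rewrite /= geq_max => /andP[ki kp] tr.
  move eqx : (None : fstate (while_frag i c (compile p))) => x H.
  (* The induction on runs needs a statement about states inside the body too: from there, the run
     first finishes the body at some tapes [t2] and then executes the whole loop. *)
  have : (if x is Some s return Prop then
      exists2 t2, runs g s t t2 &
       forall r, repr t2 r -> exists2 r1, exec g (While i c p) r r1 & repr t1 r1
    else forall r, repr t r -> exists2 r1, exec g (While i c p) r r1 & repr t1 r1).
    elim: H {eqx} => {r tr t t1 x} [x t t1|x t x1 t1 t2].
      case: x => [s|] /=.
        by rewrite istep_map; case: (istep _ _ _) => [[]|].
      case=> cr <- r tr; move: cr; rewrite (ohead_repr ki tr).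
      case: ifP => // cr _; exists r; first by apply: EWhileF; rewrite cr.
      exact: repr_stay.
    case: x => [s|] /=.
      rewrite istep_map; case E: (istep _ _ _) => [[[q|] u]|] //= [<- <-] _.
        by case=> t3 H3 H4; exists t3 => //; apply: runs_next H3.
      by move=> IH; exists u => //; apply: runs_exit.
    case=> + <- _ => cr IH r tr; move: cr; rewrite (ohead_repr ki tr).
    case: ifP => // cr [e]; move: IH; rewrite -e => -[t3 H3 H4].
    have [r3 E3 tr3] := IHp _ _ _ kp (repr_stay tr) H3.
    have [r4 E4 tr4] := H4 _ tr3.
    by exists r4 => //; apply: EWhileT E3 E4.
  by rewrite -eqx; apply.
Qed.

(** Ensures that a compiled machine can halt only at the exit [None]. *)
Lemma compile_nohalt p (s : fstate (compile p)) : fcode s <> Halt _ _.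
Proof.
elim: p s => [i b|i|i||p IHp q IHq|i c p IHp q IHq|i c p IHp] //=.
- by case=> s /=; [move: (IHp s) | move: (IHq s)]; case: (fcode s).
- case=> [[s|s]|] //=; [move: (IHp s)|move: (IHq s)]; by case: (fcode s).
- by case=> [s|] //=; move: (IHp s); case: (fcode s).
Qed.

Definition machine (p : cmd) (out : nat) : otm :=
  @OTM k.+1 (option (fstate (compile p))) (Some (fentry (compile p)))
    ord0 (inord out) (fun s => if s is Some s then fcode s else Halt _ _).

Lemma machineP p out g ws w : width p <= k -> out <= k ->
  (exists t (c : config (machine p out)),
     [/\ iter t (obind (step g)) (Some (init _ ws)) = Some c,
         halted c & read_word (c.2 (inord out)) = w]) <->
  (exists2 r, exec g p (nth [::] ws) r & r out = w).
Proof.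
move=> kp ko; set M := machine p out.
have stepE s t : @step M g (Some s, t) = istep g (fcode s) t.
  by rewrite /step /istep /=; case: (fcode s).
have ir : repr (init M ws).2 (nth [::] ws).
  by move=> i ik; rewrite ffunE read_tape_of inordK.
have runE s t (t1 : tapes) : runs g s t t1 <-> exists n,
    iter n (obind (step g)) (Some (Some s, t) : option (config M)) = Some (None, t1).
  split=> [|[n]].
    elim=> {s t t1} [s t t1 e|s t s1 t1 t2 e _ [n IH]].
      by exists 1; rewrite /= stepE.
    by exists n.+1; rewrite iterSr /= stepE e.
  elim: n s t => // n IH s t; rewrite iterSr /= stepE.
  case e: (istep _ _ _) => [[[s1|] u]|]; last by rewrite /= iter_None.
    by move=> /IH; apply: runs_next.
  case: n {IH} => [|n]; first by case=> <-; apply: runs_exit.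
  by rewrite iterSr /= iter_None.
split=> [[n [[s t1] [e hc <-]]]|[r E <-]].
  case: s e hc => [s|] e; first by rewrite /halted /=; move: (@compile_nohalt p s); case: (fcode s).
  move=> _; have /runE H : exists n, iter n (obind (step g)) (Some (init M ws)) = Some (None, t1) by exists n.
  have [r Er tr] := exec_compile kp ir H.
  by exists r => //; rewrite tr.
have [t1 H1 tr1] := compile_exec kp E ir.
have /runE[n e] := H1.
by exists n, (None, t1); split => //=; rewrite tr1.
Qed.

End Compile.

(** * Total recursive functions between coded types *)

(** A self-delimiting code: a marker 1 before each bit of [u], then a marker 0 before [v]. It is
    never empty, which leaves the empty word free to code the empty sequence. *)
Definition pairw (u v : word) : word := foldr (fun b w => true :: b :: w) (false :: v) u.

Fixpoint fstw (w : word) : word :=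
  if w is true :: b :: w' then b :: fstw w' else [::].

Fixpoint sndw (w : word) : word :=
  match w with
  | true :: w' => if w' is _ :: w'' then sndw w'' else [::]
  | false :: w' => w'
  | [::] => [::]
  end.

Lemma fstwK u v : fstw (pairw u v) = u.
Proof. by elim: u => //= b u ->. Qed.

Lemma sndwK u v : sndw (pairw u v) = v.
Proof. by elim: u. Qed.

(** Injectivity suffices to compute on codes; a recursive decoding is required separately, by
    [decodable], of the types that are read back from numbers. *)
Class code (X : Type) := Code { enc : X -> word; enc_inj : injective enc }.

#[global] Instance code_word : code word := @Code word id (@inj_id word).

Lemma unary_inj : injective unary.
Proof. by move=> m n /(congr1 size); rewrite !size_nseq. Qed.
#[global] Instance code_nat : code nat := Code unary_inj.

Lemma enc_bool_inj : injective (fun b : bool => unary b).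
Proof. by move=> [] []. Qed.
#[global] Instance code_bool : code bool := Code enc_bool_inj.

Lemma enc_pair_inj X Y (cX : code X) (cY : code Y) :
  injective (fun x : X * Y => pairw (enc x.1) (enc x.2)).
Proof.
move=> [x y] [x' y'] /= e; move: (congr1 fstw e) (congr1 sndw e).
by rewrite !fstwK !sndwK => /(@enc_inj _ cX)-> /(@enc_inj _ cY)->.
Qed.
#[global] Instance code_prod X Y (cX : code X) (cY : code Y) : code (X * Y) :=
  Code (@enc_pair_inj X Y cX cY).

Lemma enc_option_inj X (cX : code X) :
  injective (fun x : option X => if x is Some x then true :: enc x else [::]).
Proof. by move=> [x|] [y|] //= [/(@enc_inj _ cX)->]. Qed.
#[global] Instance code_option X (cX : code X) : code (option X) :=
  Code (@enc_option_inj X cX).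

Fixpoint enc_seq X (cX : code X) (s : seq X) : word :=
  if s is x :: s' then pairw (enc x) (enc_seq cX s') else [::].

Lemma enc_seq_inj X (cX : code X) : injective (@enc_seq X cX).
Proof.
elim=> [|x s IH] [|y t] //=; [by case: (enc y)|by case: (enc x)|].
move=> e; move: (congr1 fstw e) (congr1 sndw e).
by rewrite !fstwK !sndwK => /(@enc_inj _ cX)-> /IH->.
Qed.
#[global] Instance code_syms : code (seq symbol) := Code (@enc_seq_inj symbol _).

Lemma enc_ffun_inj (I : finType) X (cX : code X) :
  injective (fun f : {ffun I -> X} => enc_seq cX [seq f i | i <- enum I]).
Proof.
move=> f f' /enc_seq_inj /eq_in_map e; apply/ffunP => i.
by apply: e; rewrite mem_enum.
Qed.
#[global] Instance code_ffun (I : finType) X (cX : code X) : code {ffun I -> X} :=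
  Code (@enc_ffun_inj I X cX).

Lemma enc_fin_inj (T : finType) : injective (fun x : T => unary (enum_rank x)).
Proof. by move=> x y /unary_inj/val_inj/enum_rank_inj. Qed.
#[global] Instance code_state (M : otm) : code (state M) := Code (@enc_fin_inj (state M)).

(** * Total correctness of register programs *)

Definition wp (g : pfun nat nat) (p : cmd) (Q : regs -> Prop) (r : regs) :=
  exists2 r', exec g p r r' & Q r'.

Section WP.
Variable g : pfun nat nat.

Lemma wp_mono p (Q Q' : regs -> Prop) r :
  wp g p Q r -> (forall r, Q r -> Q' r) -> wp g p Q' r.
Proof. by case=> r' ? ? QQ; exists r'; auto. Qed.

Lemma wp_seq p q Q r : wp g p (wp g q Q) r -> wp g (Seq p q) Q r.
Proof. by case=> r1 E1 [r2 E2 Qr]; exists r2 => //; apply: ESeq E1 E2. Qed.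

Lemma wp_push i b (Q : regs -> Prop) r :
  Q (upd r i (b :: r i)) -> wp g (Push i b) Q r.
Proof. by move=> ?; eexists; [apply: EPush|]. Qed.

Lemma wp_pop i (Q : regs -> Prop) r : Q (upd r i (behead (r i))) -> wp g (Pop i) Q r.
Proof. by move=> ?; eexists; [apply: EPop|]. Qed.

Lemma wp_clear i (Q : regs -> Prop) r : Q (upd r i [::]) -> wp g (Clear i) Q r.
Proof. by move=> ?; eexists; [apply: EClear|]. Qed.

Lemma wp_if i (c : pred symbol) p q Q r :
  (if c (ohead (r i)) then wp g p Q r else wp g q Q r) -> wp g (If i c p q) Q r.
Proof.
case: ifP => cr [r' E Qr]; exists r' => //; first exact: EIfT.
by apply: EIfF; rewrite ?cr.
Qed.

Lemma wp_while i (c : pred symbol) p Q r :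
  (if c (ohead (r i)) then wp g p (wp g (While i c p) Q) r else Q r) ->
  wp g (While i c p) Q r.
Proof.
case: ifP => cr; last by exists r => //; apply: EWhileF; rewrite cr.
by case=> r1 E1 [r2 E2 Qr]; exists r2 => //; apply: EWhileT E1 E2.
Qed.

(** By determinism, what is proved about some execution holds of the given one; the arguments about
    divergence reuse the correctness lemmas in this way. *)
Lemma wp_exec p Q r r' : wp g p Q r -> exec g p r r' -> Q r'.
Proof. by case=> r1 E1 Q1 E2; rewrite -(exec_det E1 E2). Qed.

End WP.

Definition same (r r' : regs) (D : pred nat) := forall l, l \notin D -> r' l = r l.

Definition is_bit : pred symbol := fun s => s.
Definition is_one : pred symbol := fun s => s == Some true.

Lemma updE r i w : upd r i w i = w. Proof. by rewrite /upd eqxx. Qed.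
Lemma updN r i w j : j != i -> upd r i w j = r j.
Proof. by rewrite /upd => /negbTE->. Qed.

Section Registers.
Implicit Types i j k s : nat.

Lemma neqF (i j : nat) : i != j -> ((i == j) = false) * ((j == i) = false).
Proof. by move=> ij; rewrite (eq_sym j) (negbTE ij). Qed.

Definition pop_then (i : nat) (p : bool -> cmd) : cmd :=
  If i is_one (Seq (Pop i) (p true)) (Seq (Pop i) (p false)).

Lemma wp_pop_then g i p b w Q r : r i = b :: w ->
  wp g (p b) Q (upd r i w) -> wp g (pop_then i p) Q r.
Proof.
move=> ri H; apply: wp_if; rewrite ri /=.
by case: b ri H => ri H; apply: wp_seq; apply: wp_pop; rewrite ri.
Qed.

Definition dup (i j k : nat) : cmd :=
  While i is_bit (pop_then i (fun b => Seq (Push j b) (Push k b))).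

Lemma wp_dup g i j k r : uniq [:: i; j; k] ->
  wp g (dup i j k) (fun r' => [/\ r' i = [::], r' j = rev (r i) ++ r j,
    r' k = rev (r i) ++ r k & same r r' (mem [:: i; j; k])]) r.
Proof.
rewrite /= !inE negb_or andbT => /andP[/andP[ij ik] jk].
have E := (eqxx, neqF ij, neqF ik, neqF jk).
have [n] := ubnP (size (r i)); elim: n r => // n IH r; rewrite ltnS => rn.
apply: wp_while; case ri: (r i) => [|b w] /=; first by [].
apply: (wp_pop_then ri); apply: wp_seq; apply: wp_push; apply: wp_push.
apply: wp_mono; first by apply: IH; rewrite /upd !E; move: rn; rewrite ri /=; lia.
move=> r' []; rewrite /upd !E => h1 h2 h3 h4; split => //.
- by rewrite h2 rev_cons cat_rcons.
- by rewrite h3 rev_cons cat_rcons.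
- move=> l lD; move: (lD); rewrite !inE !negb_or => /and3P[li lj lk].
  by rewrite h4 // /upd !(neqF li, neqF lj, neqF lk).
Qed.

Definition pour (i j : nat) : cmd := While i is_bit (pop_then i (Push j)).

Lemma wp_pour g i j r : i != j ->
  wp g (pour i j) (fun r' => [/\ r' i = [::], r' j = rev (r i) ++ r j
    & same r r' (mem [:: i; j])]) r.
Proof.
move=> ij; have E := (eqxx, neqF ij).
have [n] := ubnP (size (r i)); elim: n r => // n IH r; rewrite ltnS => rn.
apply: wp_while; case ri: (r i) => [|b w] /=; first by [].
apply: (wp_pop_then ri); apply: wp_push.
apply: wp_mono; first by apply: IH; rewrite /upd !E; move: rn; rewrite ri /=; lia.
move=> r' []; rewrite /upd !E => h1 h2 h4; split => //.
- by rewrite h2 rev_cons cat_rcons.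
- move=> l lD; move: (lD); rewrite !inE !negb_or => /andP[li lj].
  by rewrite h4 // /upd !(neqF li, neqF lj).
Qed.

(** Stacks can only be read destructively: [i] is poured into [s], which reverses it, and pouring
    back into both [i] and [j] restores the order. *)
Definition copy (s i j : nat) : cmd :=
  Seq (Clear s) (Seq (pour i s) (Seq (Clear j) (dup s i j))).

Lemma wp_copy g s i j r : uniq [:: s; i; j] ->
  wp g (copy s i j) (fun r' => r' j = r i /\ same r r' (mem [:: s; j])) r.
Proof.
move=> U; move: (U); rewrite /= !inE negb_or andbT => /andP[/andP[si sj] ij].
apply: wp_seq; apply: wp_clear; apply: wp_seq.
apply: wp_mono (wp_pour _ _ _) _; first by rewrite eq_sym.
move=> r1 [h1 h2 h3]; apply: wp_seq; apply: wp_clear.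
apply: wp_mono (wp_dup _ _ U) _ => r2 [k1 k2 k3 k4].
have r1s : r1 s = rev (r i) by rewrite h2 updE updN 1?eq_sym // cats0.
split; first by rewrite k3 updE updN // r1s revK cats0.
move=> l; rewrite !inE negb_or => /andP[ls lj].
case: (eqVneq l i) => [->|li].
  by rewrite k2 !updN // h1 r1s revK cats0.
by rewrite k4 ?inE ?negb_or ?ls ?li // updN // h3 ?inE ?negb_or ?ls ?li // updN.
Qed.

(** The pair grows on the stack [k] from its end: first the second component and the marker 0, then
    the bits of [i], last one first, while [i] is restored. *)
Definition mkpair (s i j k : nat) : cmd :=
  Seq (copy s j k) (Seq (Push k false) (Seq (Clear s) (Seq (pour i s)
   (While s is_bit (pop_then s (fun b =>
      Seq (Push i b) (Seq (Push k b) (Push k true)))))))).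

Lemma wp_mkpair g s i j k r : uniq [:: s; i; j; k] ->
  wp g (mkpair s i j k)
    (fun r' => r' k = pairw (r i) (r j) /\ same r r' (mem [:: s; k])) r.
Proof.
rewrite /= !inE !negb_or andbT => /and3P[/and3P[si sj sk] /andP[ij ik] jk].
apply: wp_seq; apply: wp_mono (wp_copy _ _ _) _.
  by rewrite /= !inE negb_or sj sk jk.
move=> r1 [h1 h2]; apply: wp_seq; apply: wp_push.
apply: wp_seq; apply: wp_clear; apply: wp_seq.
apply: wp_mono (wp_pour _ _ _) _; first by rewrite eq_sym.
move=> r2 [k1 k2 k3]; have E := (eqxx, neqF si, neqF sj, neqF sk, neqF ij, neqF ik, neqF jk).
have {}k2 : r2 s = rev (r i).
  by rewrite k2 /upd !E cats0 h2 // !inE !E.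
have k4 : r2 k = false :: r j.
  by rewrite k3 ?inE /upd !E ?h1.
have k5 : same r r2 (mem [:: s; i; k]).
  move=> l; rewrite !inE !negb_or => /and3P[ls li lk].
  by rewrite k3 ?inE /upd !(neqF ls, neqF lk, neqF li) // h2 // !inE !(neqF ls, neqF lk).
suff W w r3 : r3 s = w -> wp g (While s is_bit (pop_then s (fun b =>
      Seq (Push i b) (Seq (Push k b) (Push k true)))))
    (fun r' => [/\ r' i = rev w ++ r3 i,
       r' k = foldl (fun w b => true :: b :: w) (r3 k) w &
       same r3 r' (mem [:: s; i; k])]) r3.
  apply: wp_mono (W _ _ k2) _ => r3 [m1 m2 m3]; split.
    by rewrite m2 foldl_rev k4.
  move=> l; rewrite !inE !negb_or => /andP[ls lk].
  case: (eqVneq l i) => [->|li]; first by rewrite m1 k1 revK cats0.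
  have lD : l \notin [:: s; i; k] by rewrite !inE !negb_or ls li.
  by rewrite m3 // k5.
elim: w r3 => [|b w IH] r3 r3s; apply: wp_while; rewrite r3s //=.
apply: (wp_pop_then r3s); apply: wp_seq; apply: wp_push.
apply: wp_seq; apply: wp_push; apply: wp_push.
apply: wp_mono (IH _ _) _; first by rewrite /upd !E.
move=> r4 []; rewrite /upd !E => m1 m2 m3; split => //.
- by rewrite m1 rev_cons cat_rcons.
- move=> l lD; move: (lD); rewrite !inE !negb_or => /and3P[ls li lk].
  by rewrite m3 // /upd !(neqF ls, neqF li, neqF lk).
Qed.

(** The marker 0 is left on [i], hence the [behead] in the specification. The case of a marker 1
    without a following bit is for words that are not pairs, on which [fstw] and [sndw] have values
    too. *)
Definition unpair (i s : nat) : cmd :=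
  Seq (Clear s) (While i is_one (Seq (Pop i)
    (If i is_bit (pop_then i (Push s)) (Pop i)))).

Lemma wp_unpair g i s r : i != s ->
  wp g (unpair i s) (fun r' => [/\ r' s = rev (fstw (r i)),
     behead (r' i) = sndw (r i) & same r r' (mem [:: i; s])]) r.
Proof.
move=> si; apply: wp_seq; apply: wp_clear.
suff W w r3 : r3 i = w -> wp g (While i is_one (Seq (Pop i)
    (If i is_bit (pop_then i (Push s)) (Pop i))))
   (fun r' => [/\ r' s = rev (fstw w) ++ r3 s,
     behead (r' i) = sndw w & same r3 r' (mem [:: i; s])]) r3.
  apply: wp_mono (W (r i) _ _) _; first by rewrite updN.
  move=> r' [h1 h2 h3]; split => //; first by rewrite h1 updE cats0.
  by move=> l lD; rewrite h3 // updN //; move: lD; rewrite !inE negb_or => /andP[].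
have [n] := ubnP (size w); elim: n w r3 => // n IH w r3; rewrite ltnS => wn r3i.
apply: wp_while; rewrite r3i; case: w wn r3i => [|[] w] wn r3i //=.
apply: wp_seq; apply: wp_pop; apply: wp_if; rewrite updE r3i /=.
case: w wn r3i => [|b w] wn r3i /=.
  apply: wp_pop; apply: wp_while; rewrite !updE /=; split => //.
    by rewrite !updN // eq_sym.
  by move=> l; rewrite !inE negb_or => /andP[li ls]; rewrite !updN.
apply: (@wp_pop_then _ _ _ b w); first by rewrite updE.
apply: wp_push; apply: wp_mono (IH w _ _ _) _.
- by move: wn => /=; lia.
- by rewrite /upd !(eqxx, neqF si).
move=> r' []; rewrite /upd !(eqxx, neqF si) => h1 h2 h3; split => //.
  by rewrite h1 rev_cons cat_rcons.
move=> l lD; move: (lD); rewrite !inE negb_or => /andP[li ls].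
by rewrite h3 // !(neqF li, neqF ls).
Qed.

End Registers.

(* [e a] transforms [u i] into [v i] inside register [a], preserving the
   registers below [a] (except 0, which serves for oracle queries) and using
   those above [a] as scratch space. *)
Definition transforms g (e : nat -> cmd) (I : Type) (u v : I -> word) : Prop :=
  forall a, 0 < a -> forall r i, r a = u i ->
  wp g (e a) (fun r' => r' a = v i /\ forall l, 0 < l < a -> r' l = r l) r.

Section Transforms.
Variables (g : pfun nat nat) (I : Type).
Implicit Types (e : nat -> cmd) (u v w : I -> word).

Lemma transforms_comp e1 e2 u v w : transforms g e1 u v ->
  transforms g e2 v w -> transforms g (fun a => Seq (e1 a) (e2 a)) u w.
Proof.
move=> h1 h2 a a0 r i ra; apply: wp_seq.
apply: wp_mono (h1 _ a0 _ _ ra) _ => r1 [r1a s1].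
apply: wp_mono (h2 _ a0 _ _ r1a) _ => r2 [r2a s2]; split=> // l lb.
by rewrite s2 // s1.
Qed.

Lemma transforms_pair e1 e2 u v w : transforms g e1 u v -> transforms g e2 u w ->
  transforms g (fun a => Seq (copy a.+3 a a.+1) (Seq (e1 a.+1)
    (Seq (copy a.+3 a a.+2) (Seq (e2 a.+2) (mkpair a.+3 a.+1 a.+2 a)))))
    u (fun i => pairw (v i) (w i)).
Proof.
move=> h1 h2 a a0 r i ra.
apply: wp_seq; apply: wp_mono (wp_copy _ _ _) _; first by rewrite /= !inE; lia.
move=> r1 [r1a s1].
apply: wp_seq; apply: wp_mono (h1 a.+1 isT r1 i _) _; first by rewrite r1a.
move=> r2 [r2a s2].
apply: wp_seq; apply: wp_mono (wp_copy _ _ _) _; first by rewrite /= !inE; lia.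
move=> r3 [r3a s3].
apply: wp_seq; apply: wp_mono (h2 a.+2 isT r3 i _) _.
  by rewrite r3a s2 ?s1 // ?inE; lia.
move=> r4 [r4a s4].
apply: wp_mono (wp_mkpair _ _ _) _; first by rewrite /= !inE; lia.
move=> r5 [r5a s5]; split.
  by rewrite r5a r4a s4 ?s3 ?r2a // ?inE; lia.
move=> l lb; rewrite s5 ?inE; last by lia.
rewrite s4; last by lia.
rewrite s3 ?inE; last by lia.
rewrite s2; last by lia.
by rewrite s1 // !inE; lia.
Qed.

(** Each branch is specified only on the subtype where it is taken: in [rec_odflt], popping the tag
    is right only for [Some], and the constant only for [None]. *)
Lemma transforms_if e e1 e2 (c : pred symbol) u v w :
  transforms g e u v ->
  transforms g e1 (fun i : {i | c (ohead (v i))} => u (sval i)) (w \o sval) ->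
  transforms g e2 (fun i : {i | ~~ c (ohead (v i))} => u (sval i)) (w \o sval) ->
  transforms g (fun a => Seq (copy a.+2 a a.+1) (Seq (e a.+1)
    (If a.+1 c (e1 a) (e2 a)))) u w.
Proof.
move=> h h1 h2 a a0 r i ra.
apply: wp_seq; apply: wp_mono (wp_copy _ _ _) _; first by rewrite /= !inE; lia.
move=> r1 [r1a s1].
apply: wp_seq; apply: wp_mono (h a.+1 isT r1 i _) _; first by rewrite r1a.
move=> r2 [r2a s2]; apply: wp_if; rewrite r2a.
have r2u : r2 a = u i by rewrite s2 ?s1 ?inE //; lia.
have rl l : 0 < l < a -> r2 l = r l.
  by move=> lb; rewrite s2 ?s1 ?inE //; lia.
case: ifPn => ci.
  apply: wp_mono (h1 a a0 r2 (exist _ i ci) _) _ => //.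
  by move=> r3 [r3a s3]; split => // l lb; rewrite s3 // rl.
apply: wp_mono (h2 a a0 r2 (exist _ i ci) _) _ => //.
by move=> r3 [r3a s3]; split => // l lb; rewrite s3 // rl.
Qed.

Lemma transforms_iter (X : Type) e1 e2 e3 u (n : I -> nat) (x : X -> word) (x0 : I -> X)
    (f : I -> X -> X) :
  transforms g e1 u (unary \o n) -> transforms g e2 u (x \o x0) ->
  transforms g e3 (fun ix : I * X => pairw (u ix.1) (x ix.2))
    (fun ix => x (f ix.1 ix.2)) ->
  transforms g (fun a => Seq (copy a.+3 a a.+1) (Seq (e1 a.+1)
    (Seq (copy a.+3 a a.+2) (Seq (e2 a.+2)
    (Seq (While a.+1 is_bit (Seq (Pop a.+1) (Seq (mkpair a.+4 a a.+2 a.+3)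
       (Seq (e3 a.+3) (copy a.+4 a.+3 a.+2))))) (copy a.+3 a.+2 a))))))
    u (fun i => x (iter (n i) (f i) (x0 i))).
Proof.
move=> h1 h2 h3 a a0 r i ra.
apply: wp_seq; apply: wp_mono (wp_copy _ _ _) _; first by rewrite /= !inE; lia.
move=> r1 [r1a s1].
apply: wp_seq; apply: wp_mono (h1 a.+1 isT r1 i _) _; first by rewrite r1a.
move=> r2 [r2a s2].
apply: wp_seq; apply: wp_mono (wp_copy _ _ _) _; first by rewrite /= !inE; lia.
move=> r3 [r3a s3].
apply: wp_seq; apply: wp_mono (h2 a.+2 isT r3 i _) _.
  by rewrite r3a s2 ?s1 // ?inE; lia.
move=> r4 [r4a s4].
apply: wp_seq.
have r4u : r4 a = u i.
  by rewrite s4 ?s3 ?inE ?s2 ?s1 ?inE //; lia.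
have r4n : r4 a.+1 = unary (n i) by rewrite s4 ?s3 ?inE ?r2a //; lia.
have r4l l : 0 < l < a -> r4 l = r l.
  by move=> lb; rewrite s4 ?s3 ?inE ?s2 ?s1 ?inE //; lia.
suff W k y r5 : r5 a = u i -> r5 a.+1 = unary k -> r5 a.+2 = x y ->
    wp g (While a.+1 is_bit (Seq (Pop a.+1) (Seq (mkpair a.+4 a a.+2 a.+3)
       (Seq (e3 a.+3) (copy a.+4 a.+3 a.+2)))))
     (fun r' => r' a.+2 = x (iter k (f i) y) /\ forall l, 0 < l < a -> r' l = r5 l) r5.
  apply: wp_mono (W _ _ _ r4u r4n r4a) _ => r5 [r5a s5].
  apply: wp_mono (wp_copy _ _ _) _; first by rewrite /= !inE; lia.
  move=> r6 [r6a s6]; split; first by rewrite r6a r5a.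
  by move=> l lb; rewrite s6 ?s5 ?r4l // !inE; lia.
elim: k y r5 => [|k IH] y r5 r5u r5n r5a; apply: wp_while; rewrite r5n //=.
apply: wp_seq; apply: wp_pop; rewrite r5n /=.
apply: wp_seq; apply: wp_mono (wp_mkpair _ _ _) _; first by rewrite /= !inE; lia.
move=> r6 [r6a s6].
apply: wp_seq; apply: wp_mono (h3 a.+3 isT r6 (i, y) _) _.
  by rewrite r6a !updN ?r5u ?r5a //; lia.
move=> r7 [r7a s7].
apply: wp_mono (wp_copy _ _ _) _; first by rewrite /= !inE; lia.
move=> r8 [r8a s8].
apply: wp_mono (IH (f i y) r8 _ _ _) _.
- by rewrite s8 ?inE ?s7 ?s6 ?inE ?updN //; lia.
- by rewrite s8 ?inE ?s7 ?s6 ?inE ?updE //; lia.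
- by rewrite r8a r7a.
move=> r9 [r9a s9]; split; first by rewrite r9a -iterSr.
by move=> l lb; rewrite s9 // s8 ?inE ?s7 ?s6 ?inE ?updN //; lia.
Qed.

Lemma transforms_id u : transforms g (fun a => copy a.+2 a a.+1) u u.
Proof.
move=> a a0 r i ra; apply: wp_mono (wp_copy _ _ _) _; first by rewrite /= !inE; lia.
by move=> r1 [r1a s1]; split=> [|l lb]; rewrite s1 // !inE; lia.
Qed.

Lemma transforms_push u b : transforms g (fun a => Push a b) u (fun i => b :: u i).
Proof.
by move=> a a0 r i ra; apply: wp_push; split=> [|l lb]; rewrite ?updE ?ra ?updN //; lia.
Qed.

Lemma transforms_pop u : transforms g Pop u (fun i => behead (u i)).
Proof.
by move=> a a0 r i ra; apply: wp_pop; split=> [|l lb]; rewrite ?updE ?ra ?updN //; lia.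
Qed.

Lemma transforms_clear u : transforms g Clear u (fun=> [::]).
Proof.
by move=> a a0 r i ra; apply: wp_clear; split=> [|l lb]; rewrite ?updE ?updN //; lia.
Qed.

Lemma transforms_fst u : transforms g (fun a => Seq (unpair a a.+1)
  (Seq (Clear a) (pour a.+1 a))) u (fstw \o u).
Proof.
move=> a a0 r i ra; apply: wp_seq; apply: wp_mono (wp_unpair _ _ _) _; first by lia.
move=> r1 [r1a _ s1]; apply: wp_seq; apply: wp_clear.
apply: wp_mono (wp_pour _ _ _) _; first by lia.
move=> r2 [_ r2a s2]; split.
  by rewrite r2a updE updN ?r1a ?revK ?cats0 ?ra //; lia.
by move=> l lb; rewrite s2 ?inE ?updN ?s1 ?inE //; lia.
Qed.

Lemma transforms_snd u : transforms g (fun a => Seq (unpair a a.+1) (Pop a))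
  u (sndw \o u).
Proof.
move=> a a0 r i ra; apply: wp_seq; apply: wp_mono (wp_unpair _ _ _) _; first by lia.
move=> r1 [_ r1a s1]; apply: wp_pop; split; first by rewrite updE r1a ra.
by move=> l lb; rewrite updN ?s1 ?inE //; lia.
Qed.

Lemma transforms_ask u (h : nat -> nat) : (forall n, g n = Some (h n)) ->
  transforms g (fun a => Seq (copy a.+1 a 0) (Seq Ask (copy a.+1 0 a)))
    u (fun i => unary (h (lead (u i)))).
Proof.
move=> gh a a0 r i ra.
apply: wp_seq; apply: wp_mono (wp_copy _ _ _) _; first by rewrite /= !inE; lia.
move=> r1 [r1a s1]; apply: wp_seq.
eexists; first by apply: EAsk; rewrite r1a ra gh.
apply: wp_mono (wp_copy _ _ _) _; first by rewrite /= !inE; lia.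
move=> r2 [r2a s2]; split; first by rewrite r2a updE.
by move=> l lb; rewrite s2 ?inE ?updN ?s1 ?inE //; lia.
Qed.

End Transforms.

(** The empty oracle always answers 0, whose unary word is empty, so clearing register 0 has the
    effect of a query and works with every oracle, partial ones included. *)
Fixpoint strip (p : cmd) : cmd :=
  match p with
  | Ask => Clear 0
  | Seq p q => Seq (strip p) (strip q)
  | If i c p q => If i c (strip p) (strip q)
  | While i c p => While i c (strip p)
  | _ => p
  end.

Lemma exec_strip g p r r' : exec (char_fun set0) p r r' -> exec g (strip p) r r'.
Proof.
elim=> {p r r'} /=; try by constructor.
- move=> r m [<-]; rewrite asboolF //=; exact: EClear.
- by move=> p q r r1 r2 _ h1 _ h2; apply: ESeq h1 h2.
- by move=> i c p r r1 r2 cr _ h1 _ h2; apply: EWhileT h1 h2.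
Qed.

Lemma transforms_strip g e I (u v : I -> word) :
  transforms (char_fun set0) e u v -> transforms g (fun a => strip (e a)) u v.
Proof.
move=> h a a0 r i ra; have [r' E Q] := h a a0 r i ra.
by exists r' => //; apply: exec_strip.
Qed.

(** * Closure properties of total recursive functions *)

Definition rec (g : pfun nat nat) (X Y : Type) (cX : code X) (cY : code Y) (f : X -> Y) :=
  exists e, transforms g e (fun x : X => enc x) (fun x => enc (f x)).
Arguments rec g {X Y cX cY} f.

Lemma rec_strip g X Y (cX : code X) (cY : code Y) (f : X -> Y) :
  rec (char_fun set0) f -> rec g f.
Proof. by case=> e h; exists (fun a => strip (e a)); apply: transforms_strip. Qed.


Section Closure.
Variable g : pfun nat nat.
Section Basic.
Context {X Y Z : Type} {cX : code X} {cY : code Y} {cZ : code Z}.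

Lemma rec_ext (f f' : X -> Y) : rec g f -> (forall x, f x = f' x) -> rec g f'.
Proof. by move=> rf /funext <-. Qed.

Lemma rec_id : rec g (fun x : X => x).
Proof. by eexists; apply: transforms_id. Qed.

Lemma rec_comp (f : Y -> Z) (h : X -> Y) : rec g f -> rec g h -> rec g (fun x => f (h x)).
Proof.
case=> e1 h1 [e2 h2]; eexists; apply: transforms_comp h2 _.
by move=> a a0 r i; apply: h1.
Qed.

Lemma rec_pair (f : X -> Y) (h : X -> Z) : rec g f -> rec g h ->
  rec g (fun x => (f x, h x)).
Proof. by case=> e1 h1 [e2 h2]; eexists; apply: (transforms_pair h1 h2). Qed.

(** Programs see only codes, so values of different types with the same code are interchangeable. *)
Lemma rec_recode (h : X -> Y) (f : X -> Z) : rec g h ->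
  (forall x, enc (f x) = enc (h x)) -> rec g f.
Proof. by case=> e he fh; exists e => a a0 r i /(he _ a0); rewrite fh. Qed.

Lemma rec_push b (h : X -> Y) (f : X -> Z) : rec g h ->
  (forall x, enc (f x) = b :: enc (h x)) -> rec g f.
Proof.
case=> e he /funext fh; eexists; rewrite fh.
by apply: transforms_comp he _; apply: transforms_push.
Qed.

Lemma rec_pop (h : X -> Y) (f : X -> Z) : rec g h ->
  (forall x, enc (f x) = behead (enc (h x))) -> rec g f.
Proof.
case=> e he /funext fh; eexists; rewrite fh.
by apply: transforms_comp he _; apply: transforms_pop.
Qed.

Lemma rec_fstw (h : X -> Y) (f : X -> Z) : rec g h ->
  (forall x, enc (f x) = fstw (enc (h x))) -> rec g f.
Proof.
case=> e he /funext fh; eexists; rewrite fh.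
by apply: transforms_comp he _; apply: transforms_fst.
Qed.

Lemma rec_sndw (h : X -> Y) (f : X -> Z) : rec g h ->
  (forall x, enc (f x) = sndw (enc (h x))) -> rec g f.
Proof.
case=> e he /funext fh; eexists; rewrite fh.
by apply: transforms_comp he _; apply: transforms_snd.
Qed.

Lemma rec_const (y : Y) : rec g (fun _ : X => y).
Proof.
rewrite /rec; elim: (enc y) => [|b w [e he]]; first by exists Clear; apply: transforms_clear.
by eexists; apply: transforms_comp he _; apply: transforms_push.
Qed.

Lemma rec_iftop (c : pred symbol) (t : X -> Y) (f h : X -> Z) : rec g t -> rec g f ->
  rec g h -> rec g (fun x => if c (ohead (enc (t x))) then f x else h x).
Proof.
case=> e he [e1 h1] [e2 h2]; eexists; apply: (transforms_if (c := c) he).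
  by move=> a a0 r [i ci]; rewrite /= ci; apply: h1.
by move=> a a0 r [i ci]; rewrite /= (negbTE ci); apply: h2.
Qed.

Lemma rec_iter (n : X -> nat) (y : X -> Y) (f : X * Y -> Y) : rec g n -> rec g y ->
  rec g f -> rec g (fun x => iter (n x) (fun z => f (x, z)) (y x)).
Proof.
move=> [e1 h1] [e2 h2] [e3 h3]; eexists.
by apply: (transforms_iter (f := fun x z => f (x, z)) h1 h2) => a a0 r [i z]; apply: h3.
Qed.

End Basic.

Section Conditionals.
Context {X Y Z : Type} {cX : code X} {cY : code Y} {cZ : code Z}.

Lemma rec_fst (h : X -> Y * Z) : rec g h -> rec g (fun x => (h x).1).
Proof. by move=> hh; apply: (rec_fstw hh) => x; rewrite fstwK. Qed.

Lemma rec_snd (h : X -> Y * Z) : rec g h -> rec g (fun x => (h x).2).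
Proof. by move=> hh; apply: (rec_sndw hh) => x; rewrite sndwK. Qed.

Lemma rec_if (b : X -> bool) (f h : X -> Y) : rec g b -> rec g f -> rec g h ->
  rec g (fun x => if b x then f x else h x).
Proof.
move=> hb hf hh; apply: rec_ext (rec_iftop is_bit hb hf hh) _ => x.
by rewrite /=; case: (b x).
Qed.

Lemma rec_some (h : X -> Y) : rec g h -> rec g (fun x => Some (h x)).
Proof. by move=> hh; apply: (rec_push hh). Qed.

Lemma rec_isSome (h : X -> option Y) : rec g h -> rec g (fun x => isSome (h x)).
Proof.
move=> hh; apply: rec_ext (rec_iftop is_bit hh (rec_const true) (rec_const false)) _ => x.
by rewrite /=; case: (h x).
Qed.

End Conditionals.

Section Projections.
Context {X Y Z : Type} {cX : code X} {cY : code Y} {cZ : code Z}.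

Lemma rec_fst1 : rec g (fun x : X * Y => x.1). Proof. exact: (rec_fst rec_id). Qed.
Lemma rec_snd1 : rec g (fun x : X * Y => x.2). Proof. exact: (rec_snd rec_id). Qed.

Lemma rec_odflt (y0 : Y) (h : X -> option Y) : rec g h -> rec g (fun x => odflt y0 (h x)).
Proof.
move=> hh; have H : rec g (odflt y0); last by apply: rec_comp H hh.
have [e he] := @rec_const (option Y) Y _ _ y0.
eexists; apply: (@transforms_if _ _ _ Pop e is_bit _ _ _ (@transforms_id _ _ _)).
  move=> a a0 r [[y|] //= _] ra.
  exact: (@transforms_pop g (option Y) (fun i => enc i) a a0 r (Some y) ra).
move=> a a0 r [[y|] //= _] ra.
exact: (he a a0 r None ra).
Qed.
End Projections.

Lemma rec_succ `{cX : code X} (n : X -> nat) : rec g n -> rec g (fun x => (n x).+1).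
Proof. by move=> hn; apply: (rec_push hn). Qed.

Lemma rec_pred `{cX : code X} (n : X -> nat) : rec g n -> rec g (fun x => (n x).-1).
Proof. by move=> hn; apply: (rec_pop hn) => x; case: (n x). Qed.

Lemma rec_negb `{cX : code X} (b : X -> bool) : rec g b -> rec g (fun x => ~~ b x).
Proof.
move=> hb; apply: rec_ext (rec_if hb (rec_const false) (rec_const true)) _ => x.
by case: (b x).
Qed.

Lemma rec_andb `{cX : code X} (b c : X -> bool) : rec g b -> rec g c -> rec g (fun x => b x && c x).
Proof. by move=> hb hc; apply: rec_ext (rec_if hb hc (rec_const false)) _. Qed.

Lemma rec_orb `{cX : code X} (b c : X -> bool) : rec g b -> rec g c -> rec g (fun x => b x || c x).
Proof. by move=> hb hc; apply: rec_ext (rec_if hb (rec_const true) hc) _. Qed.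

Lemma rec_implb `{cX : code X} (b c : X -> bool) : rec g b -> rec g c -> rec g (fun x => b x ==> c x).
Proof. by move=> hb hc; apply: rec_ext (rec_if hb hc (rec_const true)) _. Qed.

Lemma rec_nat_of_bool `{cX : code X} (b : X -> bool) : rec g b -> rec g (fun x => nat_of_bool (b x)).
Proof. by move=> hb; apply: (rec_recode hb). Qed.

Lemma rec_lt0n `{cX : code X} (n : X -> nat) : rec g n -> rec g (fun x => 0 < n x).
Proof.
move=> hn; apply: rec_ext (rec_iftop is_bit hn (rec_const true) (rec_const false)) _ => x.
by rewrite /=; case: (n x).
Qed.

Lemma rec_addn `{cX : code X} (n m : X -> nat) : rec g n -> rec g m -> rec g (fun x => n x + m x).
Proof.
move=> hn hm; apply: rec_ext (rec_iter hn hm (rec_succ (rec_snd rec_id))) _ => x /=.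
by elim: (n x) => //= k ->; rewrite addSn.
Qed.

Lemma rec_subn `{cX : code X} (n m : X -> nat) : rec g n -> rec g m -> rec g (fun x => n x - m x).
Proof.
move=> hn hm; apply: rec_ext (rec_iter hm hn (rec_pred (rec_snd rec_id))) _ => x /=.
by elim: (m x) => [|k /= ->]; rewrite ?subn0 // subnS.
Qed.

Lemma rec_leq `{cX : code X} (n m : X -> nat) : rec g n -> rec g m -> rec g (fun x => n x <= m x).
Proof.
move=> hn hm; apply: rec_ext (rec_negb (rec_lt0n (rec_subn hn hm))) _ => x.
by rewrite -leqNgt leqn0 subn_eq0.
Qed.

Lemma rec_eqn `{cX : code X} (n m : X -> nat) : rec g n -> rec g m -> rec g (fun x => n x == m x).
Proof.
move=> hn hm; apply: rec_ext (rec_andb (rec_leq hn hm) (rec_leq hm hn)) _ => x.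
by rewrite eqn_leq.
Qed.

Lemma rec_sum `{cX : code X} (n : X -> nat) (f : X * nat -> nat) : rec g n -> rec g f ->
  rec g (fun x => \sum_(i < n x) f (x, i : nat)).
Proof.
move=> hn hf.
have hs : rec g (fun xs : X * (nat * nat) => (xs.2.1.+1, xs.2.2 + f (xs.1, xs.2.1))).
  apply: rec_pair; first exact: rec_succ (rec_fst rec_snd1).
  apply: rec_addn; first exact: rec_snd rec_snd1.
  exact: rec_comp hf (rec_pair rec_fst1 (rec_fst rec_snd1)).
apply: rec_ext (rec_snd (rec_iter hn (rec_const (0, 0)) hs)) _ => x /=.
set it := iter _ _ _; suff -> : it = (n x, \sum_(i < n x) f (x, i : nat)) by [].
rewrite /it; elim: (n x) => [|k /= ->]; first by rewrite big_ord0.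
by rewrite big_ord_recr.
Qed.

Lemma rec_all `{cX : code X} (n : X -> nat) (f : X * nat -> bool) : rec g n -> rec g f ->
  rec g (fun x => all (fun i => f (x, i)) (iota 0 (n x))).
Proof.
move=> hn hf; have hs := rec_sum hn (rec_nat_of_bool (rec_negb hf)).
apply: rec_ext (rec_eqn hs (rec_const 0)) _ => x.
elim: (n x) => [|k IH]; first by rewrite big_ord0.
rewrite big_ord_recr -[in RHS](addn1 k) iotaD all_cat -IH /= andbT addn_eq0.
by congr (_ && _); case: (f _).
Qed.

Lemma rec_has `{cX : code X} (n : X -> nat) (f : X * nat -> bool) : rec g n -> rec g f ->
  rec g (fun x => has (fun i => f (x, i)) (iota 0 (n x))).
Proof.
move=> hn hf; apply: rec_ext (rec_negb (rec_all hn (rec_negb hf))) _ => x.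
by rewrite -has_predC; apply: eq_has => i /=; rewrite negbK.
Qed.

(** Half of [n] is obtained as the number of [k < n] such that [k.+1.*2 <= n]. *)
Lemma rec_half `{cX : code X} (n : X -> nat) : rec g n -> rec g (fun x => (n x)./2).
Proof.
move=> hn.
have hf : rec g (fun xm : X * nat => (xm.2.+1).*2 <= n xm.1).
  apply: rec_ext (rec_leq (rec_addn (rec_succ rec_snd1) (rec_succ rec_snd1)) (rec_comp hn rec_fst1)) _.
  by move=> x; rewrite -addnn.
apply: rec_ext (rec_sum hn (rec_nat_of_bool hf)) _ => x /=.
suff E k : \sum_(i < k) (i.+1.*2 <= n x) = minn k (n x)./2.
  by rewrite E; lia.
elim: k => [|k IH]; first by rewrite big_ord0 min0n.
by rewrite big_ord_recr IH /=; lia.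
Qed.

Lemma rec_oapp `{cX : code X, cY : code Y, cZ : code Z} (y0 : Y) (h : X -> option Y)
    (f : X * Y -> Z) (d : X -> Z) : rec g h -> rec g f -> rec g d ->
  rec g (fun x => if h x is Some y then f (x, y) else d x).
Proof.
move=> hh hf hd.
have H := rec_comp hf (rec_pair rec_id (rec_odflt y0 hh)).
by apply: rec_ext (rec_if (rec_isSome hh) H hd) _ => x; case: (h x).
Qed.

Lemma rec_eqword `{cX : code X} (h : X -> word) (w : word) : rec g h ->
  rec g (fun x => h x == w).
Proof.
move=> hh; have H : rec g (fun v : word => v == w); last exact: rec_comp H hh.
elim: w => [|b w IH].
  apply: rec_ext (rec_iftop is_bit rec_id (rec_const false) (rec_const true)) _.
  by case.
have hb : rec g (fun v : word => behead v) by apply: (rec_pop rec_id).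
apply: rec_ext (rec_iftop (pred1 (Some b)) rec_id (rec_comp IH hb) (rec_const false)) _.
by case.
Qed.

Lemma rec_eqconst `{cX : code X} (T : eqType) {cT : code T} (h : X -> T) (y : T) :
  rec g h -> rec g (fun x => h x == y).
Proof.
move=> hh; have h' : rec g (fun x => enc (h x)) by apply: (rec_recode hh).
by apply: rec_ext (rec_eqword (enc y) h') _ => x; rewrite (inj_eq (@enc_inj _ cT)).
Qed.

Lemma rec_eq `{cX : code X} (h h' : X -> option nat) :
  rec g h -> rec g h' -> rec g (fun x => h x == h' x).
Proof.
move=> hh hh'.
have H (k : X -> option nat) : rec g k -> rec g (fun x => if k x is Some n then n.+1 else 0).
  by move=> hk; apply: (rec_oapp 0 (f := fun xn => xn.2.+1) hk (rec_succ rec_snd1) (rec_const 0)).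
by apply: rec_ext (rec_eqn (H _ hh) (H _ hh')) _ => x; case: (h x) (h' x) => [m|] [n|].
Qed.

(** Each [f _ a] has to be recursive, without uniformity in [a], because finitely many cases can be
    written out. In this way the transition table of a machine, an arbitrary function on a finite
    type, becomes part of a program. *)
Lemma rec_fincase `{cX : code X, cZ : code Z} (T : finType) {cT : code T} (t0 : T)
    (t : X -> T) (f : X -> T -> Z) : rec g t ->
  (forall a, rec g (fun x => f x a)) -> rec g (fun x => f x (t x)).
Proof.
move=> ht hf.
have H (s : seq T) : rec g (fun x => if t x \in s then f x (t x) else f x t0); last first.
  by apply: rec_ext (H (enum T)) _ => x; rewrite mem_enum.
elim: s => [|a s IH]; first exact: hf.
apply: rec_ext (rec_if (rec_eqconst a ht) (hf a) IH) _ => x /=.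
by rewrite in_cons; case: eqVneq => [->|].
Qed.

Lemma rec_list `{cX : code X, cY : code Y} (I : Type) (s : seq I) (f : X -> I -> Y) :
  (forall i, rec g (fun x => f x i)) -> exists e, transforms g e (fun x : X => enc x)
     (fun x => enc_seq cY [seq f x i | i <- s]).
Proof.
move=> hf; elim: s => [|i s [e he]]; first by exists Clear; apply: transforms_clear.
by have [e' he'] := hf i; eexists; apply: transforms_pair he' he.
Qed.

Lemma rec_ffun `{cX : code X, cY : code Y} (I : finType) (f : X -> I -> Y) :
  (forall i, rec g (fun x => f x i)) -> rec g (fun x => [ffun i => f x i]).
Proof.
move=> /(rec_list (enum I))[e he]; exists e => a a0 r x ra.
apply: wp_mono (he a a0 r x ra) _ => r' [-> ?]; split => //=.
by congr (enc_seq _ _); apply: eq_map => i; rewrite ffunE.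
Qed.

Lemma rec_app `{cX : code X, cY : code Y} (I : finType) (f : X -> {ffun I -> Y}) (i : I) :
  rec g f -> rec g (fun x => f x i).
Proof.
move=> hf; have hs : rec g (fun x => enc (f x)) by apply: (rec_recode hf).
have hn k : rec g (fun x => fstw (iter k sndw (enc (f x)))).
  apply: (rec_fstw (h := fun x => iter k sndw (enc (f x)))) => //.
  elim: k => //= k IH; exact: (rec_sndw IH).
apply: (rec_recode (hn (index i (enum I)))) => x; rewrite /=.
have : i \in enum I by rewrite mem_enum.
elim: (enum I) => //= j s IH; rewrite in_cons eq_sym; case: eqVneq => [->|_ /= /IH ->].
  by rewrite fstwK.
by rewrite -iterS iterSr sndwK.
Qed.

Lemma rec_size `{cX : code X} (h : X -> word) : rec g h -> rec g (fun x => size (h x)).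
Proof.
move=> hh; have H : rec g (fun w : word => size w); last exact: rec_comp H hh.
exists (fun a => Seq (Clear a.+1) (Seq (While a is_bit (Seq (Pop a) (Push a.+1 true)))
  (copy a.+2 a.+1 a))) => a a0 r w /= ra.
apply: wp_seq; apply: wp_clear; apply: wp_seq.
suff W v k r3 : r3 a = v -> r3 a.+1 = unary k ->
    wp g (While a is_bit (Seq (Pop a) (Push a.+1 true)))
    (fun r' => r' a.+1 = unary (k + size v) /\ forall l, 0 < l < a -> r' l = r3 l) r3.
  apply: wp_mono (W w 0 _ _ _) _; [by rewrite updN ?ra //; lia|by rewrite updE|].
  move=> r1 [r1a s1]; apply: wp_mono (wp_copy _ _ _) _; first by rewrite /= !inE; lia.
  move=> r2 [r2a s2]; split; first by rewrite r2a r1a.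
  by move=> l lb; rewrite s2 ?inE ?s1 ?updN //; lia.
elim: v k r3 {r ra} => [|b v IH] k r ra rk; apply: wp_while; rewrite ra /=.
  by rewrite addn0.
apply: wp_seq; apply: wp_pop; apply: wp_push.
apply: wp_mono (IH k.+1 _ _ _) _.
- by rewrite updN ?updE ?ra //; lia.
- by rewrite updE updN ?rk //; lia.
move=> r' [r'a s']; split; first by rewrite r'a addSnnS.
by move=> l lb; rewrite s' // !updN //; lia.
Qed.
End Closure.
Arguments rec_const {g X Y cX cY} y.
Arguments rec_id {g X cX}.
Arguments rec_fst1 {g X Y cX cY}.
Arguments rec_snd1 {g X Y cX cY}.

(** * Simulation of Turing machines *)

Ltac rec_step :=
  lazymatch goal with
  | |- rec _ (fun x => x) => apply: rec_id
  | |- rec _ fst => apply: rec_fst1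
  | |- rec _ snd => apply: rec_snd1
  | |- rec _ S => apply: (rec_succ rec_id)
  | |- rec _ negb => apply: (rec_negb rec_id)
  | |- rec _ (fun x => (_, _)) => apply: rec_pair
  | |- rec _ (fun x => (_).1) => apply: rec_fst
  | |- rec _ (fun x => (_).2) => apply: rec_snd
  | |- rec _ (fun x => (_).+1) => apply: rec_succ
  | |- rec _ (fun x => (_).-1) => apply: rec_pred
  | |- rec _ (fun x => addn _ _) => apply: rec_addn
  | |- rec _ (fun x => subn _ _) => apply: rec_subn
  | |- rec _ (fun x => half _) => apply: rec_half
  | |- rec _ (fun x => leq _ _) => apply: rec_leq
  | |- rec _ (fun x => @eq_op _ _ _) => apply: rec_eqn
  | |- rec _ (fun x => ~~ _) => apply: rec_negb
  | |- rec _ (fun x => _ && _) => apply: rec_andb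
  | |- rec _ (fun x => _ || _) => apply: rec_orb
  | |- rec _ (fun x => _ ==> _) => apply: rec_implb
  | |- rec _ (fun x => nat_of_bool _) => apply: rec_nat_of_bool
  | |- rec _ (fun x => Some _) => apply: rec_some
  | |- rec _ (fun x => isSome _) => apply: rec_isSome
  | |- rec _ (fun x => size _) => apply: rec_size
  end.
Ltac rec_tac := repeat first
  [ eassumption | rec_step
  | match goal with
    | H : rec _ ?f |- rec _ (fun x => ?f _) => apply: (rec_comp H)
    | |- rec _ (fun x => if _ then _ else _) => apply: rec_if
    end
  | apply: rec_const ]; cbv beta.

Section Lists.
Variable g : pfun nat nat.

(** [Y] is seen as a type of sequences through [s]. The length of the code bounds the number of
    iterations, as each [tl] shortens the code; once the code is empty the remaining iterations
    change nothing. *)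
Lemma rec_foldl `{cX : code X, cY : code Y, cZ : code Z, cA : code A}
    (hd : Y -> A) (tl : Y -> Y) (s : Y -> seq A) (f : X * (Z * A) -> Z) (z : X -> Z)
    (l : X -> Y) :
  (forall y, if enc y is [::] then s y = [::]
    else s y = hd y :: s (tl y) /\ size (enc (tl y)) < size (enc y)) ->
  rec g hd -> rec g tl -> rec g f -> rec g z -> rec g l ->
  rec g (fun x => foldl (fun b a => f (x, (b, a))) (z x) (s (l x))).
Proof.
move=> hs hhd htl hf hz hl.
have hen : rec g (fun x => enc (l x)) by apply: (rec_recode hl).
have hst : rec g (fun xyz : X * (Y * Z) =>
    if is_bit (ohead (enc xyz.2.1)) then
      (tl xyz.2.1, f (xyz.1, (xyz.2.2, hd xyz.2.1))) else xyz.2).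
  by apply: rec_iftop; rec_tac.
have hp : rec g (fun x => (l x, z x)) by rec_tac.
apply: rec_ext (rec_snd (rec_iter (rec_size hen) hp hst)) _ => x /=.
have : size (enc (l x)) <= size (enc (l x)) by [].
move: (l x) (z x) {2 3}(size _) => y b n.
elim: n y b => [|n IH] y b yn.
  by have := hs y; move: yn; case: (enc y) => //= _ ->.
rewrite iterSr /=; have := hs y; case E: (enc y) => [|c w] /=.
  by move=> sy; rewrite IH // E.
by case=> -> tn; rewrite IH //; move: yn tn; rewrite E /=; lia.
Qed.

Lemma rec_cons `{cX : code X} (b : X -> bool) (w : X -> word) : rec g b -> rec g w ->
  rec g (fun x => b x :: w x : word).
Proof.
move=> hb hw.
have ht b0 : rec g (fun x => b0 :: w x : word) by apply: (rec_push hw).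
by apply: rec_ext (rec_if hb (ht true) (ht false)) _ => x; case: (b x).
Qed.

Lemma rec_foldl_word `{cX : code X, cZ : code Z} (f : X * (Z * bool) -> Z) z (w : X -> word) :
  rec g f -> rec g z -> rec g w -> rec g (fun x => foldl (fun b a => f (x, (b, a))) (z x) (w x)).
Proof.
move=> hf hz hw; apply: (rec_foldl (hd := fun w : word => ohead w == Some true)
  (tl := fun w : word => behead w) (s := fun w : word => w)) => //.
- by case=> [|[] v].
- by apply: rec_ext (rec_iftop is_one (@rec_id g word _) (rec_const true) (rec_const false)) _ => -[|[]].
- by apply: (rec_pop rec_id).
Qed.

Lemma rec_rev `{cX : code X} (w : X -> word) : rec g w -> rec g (fun x => rev (w x) : word).
Proof.
move=> hw; apply: rec_ext (rec_foldl_word (f := fun x => x.2.2 :: x.2.1) (z := fun _ => [::]) _ _ hw) _.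
- by apply: rec_cons; rec_tac.
- exact: rec_const.
move=> x /=; rewrite -[in LHS](revK (w x)) foldl_rev.
by elim: (rev _) => //= b v ->.
Qed.

Lemma rec_syms_cons `{cX : code X} (c : X -> symbol) (s : X -> seq symbol) :
  rec g c -> rec g s -> rec g (fun x => c x :: s x).
Proof. by move=> hc hs; apply: (rec_recode (rec_pair hc hs)). Qed.

Lemma rec_head `{cX : code X} (s : X -> seq symbol) : rec g s -> rec g (fun x => head None (s x)).
Proof. by move=> hs; apply: (rec_fstw hs) => x; case: (s x) => //= c v; rewrite fstwK. Qed.

Lemma rec_behead `{cX : code X} (s : X -> seq symbol) : rec g s -> rec g (fun x => behead (s x)).
Proof. by move=> hs; apply: (rec_sndw hs) => x; case: (s x) => //= c v; rewrite sndwK. Qed.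

Lemma size_sndw v : size (sndw v) <= (size v).-1.
Proof.
have [n] := ubnP (size v); elim: n v => // n IH [|[] [|b v]] //= vn.
by have := IH v; move: vn; lia.
Qed.

Lemma rec_foldl_syms `{cX : code X, cZ : code Z} (f : X * (Z * symbol) -> Z) z
    (s : X -> seq symbol) : rec g f -> rec g z -> rec g s ->
  rec g (fun x => foldl (fun b a => f (x, (b, a))) (z x) (s x)).
Proof.
move=> hf hz hs; apply: (rec_foldl (hd := head None) (tl := behead) (s := id)) => //.
- case=> [|c v] //.
  have -> : enc (c :: v) = pairw (enc c) (enc v) by [].
  case E: (pairw _ _) => [|b w]; first by move: E; case: (enc c).
  split=> //; rewrite -(sndwK (enc c) (enc v)) E.
  by have := size_sndw (b :: w) => /=; lia.
- exact: rec_head rec_id.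
- exact: rec_behead rec_id.
Qed.

Lemma rec_foldr_syms `{cX : code X, cZ : code Z} (f : X * (Z * symbol) -> Z) z
    (s : X -> seq symbol) : rec g f -> rec g z -> rec g s ->
  rec g (fun x => foldr (fun a b => f (x, (b, a))) (z x) (s x)).
Proof.
move=> hf hz hs.
have hr : rec g (fun x => rev (s x)).
  apply: rec_ext (rec_foldl_syms (f := fun x => x.2.2 :: x.2.1) (z := fun _ => [::]) _ _ hs) _.
  - by apply: rec_syms_cons; rec_tac.
  - exact: rec_const.
  move=> x /=; rewrite -[in LHS](revK (s x)) foldl_rev.
  by elim: (rev _) => //= b v ->.
apply: rec_ext (rec_foldl_syms hf hz hr) _ => x.
by rewrite foldl_rev.
Qed.

Lemma rec_map_some `{cX : code X} (w : X -> word) : rec g w ->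
  rec g (fun x => [seq Some b | b <- w x] : seq symbol).
Proof.
move=> hw; have hr := rec_rev hw.
apply: rec_ext (rec_foldl_word (f := fun x => Some x.2.2 :: x.2.1 : seq symbol)
  (z := fun _ => [::]) _ _ hr) _.
- by apply: rec_syms_cons; rec_tac.
- exact: rec_const.
by move=> x; rewrite foldl_rev.
Qed.

Lemma rec_read_nat `{cX : code X} (t : X -> tape) : rec g t -> rec g (fun x => read_nat (t x)).
Proof.
move=> ht; apply: rec_ext (rec_foldr_syms
  (f := fun x => if x.2.2 == Some true then x.2.1.+1 else 0) (z := fun _ => 0) _ _ (rec_snd ht)) _.
- by rec_tac; apply: rec_eqconst; rec_tac.
- exact: rec_const.
by move=> x /=; rewrite /read_nat; elim: (t x).2 => //= c s ->; case: eqP.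
Qed.

Lemma rec_read_word `{cX : code X} (t : X -> tape) : rec g t -> rec g (fun x => read_word (t x)).
Proof.
move=> ht; apply: rec_ext (rec_foldr_syms
  (f := fun x => if x.2.2 is Some b then (x, b).2 :: (x, b).1.2.1 else [::] : word)
  (z := fun _ => [::] : word) _ _ (rec_snd ht)) _.
- apply: (rec_oapp false (f := fun xb => xb.2 :: xb.1.2.1 : word)); rec_tac.
  by apply: rec_cons; rec_tac.
- exact: rec_const.
move=> x /=; case: (t x) => l s /=; elim: s => //= c s ->.
by rewrite read_word_cons.
Qed.

Lemma rec_act `{cX : code X} (t : X -> tape) a : rec g t -> rec g (fun x => act (t x) a).
Proof.
case: a => c [] ht; rewrite /act /=.
- apply: rec_pair; first exact: rec_behead (rec_fst ht).
  apply: rec_syms_cons; first exact: rec_head (rec_fst ht).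
  apply: rec_syms_cons; first exact: rec_const.
  exact: rec_behead (rec_snd ht).
- apply: rec_pair; first exact: (rec_fst ht).
  apply: rec_syms_cons; first exact: rec_const.
  exact: rec_behead (rec_snd ht).
- apply: rec_pair; last exact: rec_behead (rec_snd ht).
  apply: rec_syms_cons; first exact: rec_const.
  exact: (rec_fst ht).
Qed.

Lemma rec_tape_of `{cX : code X} (w : X -> word) : rec g w -> rec g (fun x => tape_of (w x)).
Proof. by move=> hw; apply: rec_pair; [apply: rec_const|apply: rec_map_some]. Qed.

Lemma rec_scan `{cX : code X} (t : X -> tape) : rec g t -> rec g (fun x => scan (t x)).
Proof. by move=> ht; apply: rec_head; apply: rec_snd. Qed.

End Lists.

Section Simulation.
Variable (M : otm) (g : pfun nat nat).

Lemma rec_halted `{cX : code X} (c : X -> config M) : rec g c -> rec g (fun x => halted (c x)).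
Proof.
move=> hc; apply: (rec_fincase (start M) (f := fun x q => if prog q is Halt then true else false)
   (rec_fst hc)).
by move=> q; apply: rec_const.
Qed.

Lemma rec_step_config `{cX : code X} (o : X * nat -> option nat) (c : X -> config M) :
  rec g o -> rec g c -> rec g (fun x => step (fun n => o (x, n)) (c x)).
Proof.
move=> ho hc.
apply: (rec_fincase (start M) (f := fun x q => step (fun n => o (x, n)) (q, (c x).2) ) (rec_fst hc)).
move=> q; rewrite /step /=.
have ht i : rec g (fun x => (c x).2 i) by apply: rec_app; apply: rec_snd.
case: (prog q) => [|q'|d]; first exact: rec_const.
  apply: rec_ext (rec_oapp 0 (f := fun xm => Some (q', [ffun i => if i == query_tape M
       then tape_of (unary xm.2) else (c xm.1).2 i])) (d := fun _ => None)
    (h := fun x => o (x, read_nat ((c x).2 (query_tape M)))) _ _ _) _.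
  - by apply: (rec_comp ho); rec_tac; apply: rec_read_nat.
  - rec_tac; apply: rec_ffun => i; case: (i == _); last exact: (rec_comp (ht i) rec_fst1).
    by apply: rec_tape_of; apply: (rec_recode rec_snd1).
  - exact: rec_const.
  - by move=> x; case: (o _).
have hs : rec g (fun x => [ffun i => scan ((c x).2 i)]).
  by apply: rec_ffun => i; apply: rec_scan.
apply: (rec_fincase [ffun=> None] (f := fun x v => let: (q0, a) := d v in
   Some (q0, [ffun i => act ((c x).2 i) (a i)])) hs) => v.
case: (d v) => q' a; rec_tac.
by apply: rec_ffun => i; apply: rec_act.
Qed.

End Simulation.

(* The words written on the input tapes can be gathered into one code, and
   extracted from it again. *)
Class input_code (X : Type) {iX : input X} {cX : code X} : Prop := input_codeP :
  exists n, [/\ forall x : X, size (load x) = n,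
    forall g i, rec g (fun x : X => nth [::] (load x) i) &
    exists e : nat -> nat -> cmd, forall g off a r (x : X), off + n <= a -> 0 < a ->
      (forall i, i < n -> r (off + i) = nth [::] (load x) i) ->
      wp g (e off a) (fun r' => r' a = enc x /\ forall l, l < a -> r' l = r l) r].
Arguments input_code X {iX cX}.

Class output_code (Y : Type) {oY : output Y} {cY : code Y} : Prop := output_codeP :
  (forall t (y : Y), read_word t = enc y -> unload t = y) /\
  forall g, rec g (fun t : tape => unload t : Y).
Arguments output_code Y {oY cY}.

Lemma gather1 g off a r w : off + 1 <= a -> (forall i, i < 1 -> r (off + i) = nth [::] [:: w] i) ->
  wp g (copy a.+1 off a) (fun r' => r' a = w /\ forall l, l < a -> r' l = r l) r.
Proof.
move=> oa h; apply: wp_mono (wp_copy _ _ _) _; first by rewrite /= !inE; lia.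
move=> r1 [r1a s1]; split; first by rewrite r1a -(addn0 off) h.
by move=> l lb; rewrite s1 // !inE; lia.
Qed.

#[global] Instance input_code_word : input_code word.
Proof.
exists 1; split => // [g [|i]|]; first exact: rec_id.
  by apply: rec_ext (rec_const [::]) _ => x; rewrite /= nth_nil.
by exists (fun off a => copy a.+1 off a) => g off a r x oa _; apply: gather1.
Qed.

#[global] Instance input_code_nat : input_code nat.
Proof.
exists 1; split => // [g [|i]|]; first by apply: (rec_recode (h := fun x : nat => x) rec_id).
  by apply: rec_ext (rec_const [::]) _ => x; rewrite /= nth_nil.
by exists (fun off a => copy a.+1 off a) => g off a r x oa _; apply: gather1.
Qed.

#[global] Instance input_code_prod X Y (iX : input X) (cX : code X) (iY : input Y) (cY : code Y) :
  input_code X -> input_code Y -> input_code (X * Y).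
Proof.
move=> [n [sX rX [eX hX]]] [m [sY rY [eY hY]]]; exists (n + m); split.
- by move=> x; rewrite /load /= size_cat sX sY.
- move=> g i.
  apply: (rec_ext (f := fun x => if i < n then nth [::] (load x.1) i
    else nth [::] (load x.2) (i - n))).
    by case: (i < n); [apply: (rec_comp (rX g i))|apply: (rec_comp (rY g (i - n)))]; rec_tac.
  by move=> x; rewrite /load /= nth_cat sX.
exists (fun off a => Seq (eX off a.+1) (Seq (eY (off + n) a.+2) (mkpair a.+3 a.+1 a.+2 a))).
move=> g off a r x oa a0 hr.
apply: wp_seq; apply: wp_mono (hX g off a.+1 r x.1 _ _ _) _ => //; first by lia.
  by move=> i im; rewrite hr /load /= ?nth_cat ?sX ?im //; lia.
move=> r1 [r1a s1].
apply: wp_seq; apply: wp_mono (hY g (off + n) a.+2 r1 x.2 _ _ _) _ => //; first by lia.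
  move=> i im; rewrite s1; last by lia.
  rewrite -addnA hr /load /= ?nth_cat ?sX; last by lia.
  by rewrite ltnNge leq_addr /= addKn.
move=> r2 [r2a s2].
apply: wp_mono (wp_mkpair _ _ _) _; first by rewrite /= !inE; lia.
move=> r3 [r3a s3]; split; first by rewrite r3a r2a s2 ?r1a.
by move=> l lb; rewrite s3 ?inE ?s2 ?s1 //; lia.
Qed.

#[global] Instance output_code_word : output_code word.
Proof. by split=> [t y|g]; [|apply: rec_read_word; apply: rec_id]. Qed.

#[global] Instance output_code_nat : output_code nat.
Proof.
split=> [t y ty|g]; last by apply: rec_read_nat; apply: rec_id.
rewrite [LHS]read_natE ty /=; elim: y {t ty} => //= y ->; by [].
Qed.

Lemma program_machine p out : exists M : otm, forall g ws w,
  (exists t (c : config M),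
     [/\ iter t (obind (step g)) (Some (init M ws)) = Some c,
         halted c & read_word (c.2 (output_tape M)) = w]) <->
  (exists2 r, exec g p (nth [::] ws) r & r out = w).
Proof.
exists (machine (maxn (width p) out) p out) => g ws w.
by apply: machineP; [apply: leq_maxl|apply: leq_maxr].
Qed.

(** [G] is one oracle for recursive functions and all oracles for functionals. Of the two
    hypotheses, one gives the value on the domain of [F g] and the other divergence outside it. *)
Lemma program_outputs `{cX : code X, cY : code Y} {iX : input X} {oY : output Y}
    {ioX : input_code X} {ooY : output_code Y} (G : set (pfun nat nat)) (e : nat -> cmd)
    (F : pfun nat nat -> pfun X Y) :
  (forall g a r x, G g -> 0 < a -> r a = enc x ->
     (forall y, F g x = Some y -> wp g (e a) (fun r' => r' a = enc y) r) /\
     (forall r', exec g (e a) r r' -> F g x <> None)) ->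
  exists M : otm, forall g, G g -> forall x y, F g x = Some y <-> outputs M g x y.
Proof.
have [n [sX rX [eX hX]]] := ioX; have [hY _] := ooY; move=> he.
have [M hM] := program_machine (Seq (eX 0 n.+1) (e n.+1)) n.+1.
exists M => g Gg x y.
have [r1 E1 [r1a _]] : wp g (eX 0 n.+1) (fun r' => r' n.+1 = enc x /\
    forall l, l < n.+1 -> r' l = nth [::] (load x) l) (nth [::] (load x)).
  by apply: hX => //; rewrite add0n.
have [he1 he2] := he g n.+1 r1 x Gg isT r1a.
split=> [/he1[r2 E2 r2a]|[t [c [hc hh hu]]]].
  have [|t [c [hc hh hu]]] := (hM g (load x) (enc y)).2.
    by exists r2 => //; apply: ESeq E1 E2.
  by exists t, c; split=> //; apply: hY.
have [|r2 E hr2] := (hM g (load x) (read_word (c.2 (output_tape M)))).1.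
  by exists t, c.
inversion E as [| | | |? ? ? r3 ? E3 E4| | | |]; subst.
move: E4; rewrite (exec_det E3 E1) => E4.
have := he2 _ E4; case Fy: (F g x) => [y'|] // _.
by congr Some; have := wp_exec (he1 _ Fy) E4; rewrite hr2 => /hY ->.
Qed.

(** * Unbounded search *)

Section Search.
Context `{cX : code X, cY : code Y}.
Variables (r : X * nat -> option Y) (e : nat -> cmd).
Let body a := Seq (mkpair a.+3 a a.+1 a.+2) (e a.+2).
(** Register [a.+2] receives the optional answer. Since [None] is coded by the empty word, the loop
    runs until a bit appears there, and the final [Pop] removes the tag of [Some]. *)
Definition search_cmd a := Seq (Clear a.+1) (Seq (body a)
  (Seq (While a.+2 (fun s => ~~ is_bit s) (Seq (Push a.+1 true) (body a)))
  (Seq (Pop a.+2) (copy a.+3 a.+2 a)))).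
Variable g : pfun nat nat.
Hypothesis he : transforms g e (fun x => enc x) (fun x => enc (r x)).

Let inv a x n (s : regs) := [/\ s a = enc x, s a.+1 = unary n & s a.+2 = enc (r (x, n))].

Let wp_body a x n s : 0 < a -> s a = enc x -> s a.+1 = unary n ->
  wp g (body a) (fun s' => inv a x n s' /\ forall l, 0 < l < a -> s' l = s l) s.
Proof.
move=> a0 sa sn; apply: wp_seq; apply: wp_mono (wp_mkpair _ _ _) _.
  by rewrite /= !inE; lia.
move=> s1 [s1a ss1]; apply: wp_mono (he (a := a.+2) isT (i := (x, n)) _) _.
  by rewrite s1a sa sn.
move=> s2 [s2a ss2]; split; first split => //.
- by rewrite ss2 ?ss1 ?inE //; lia.
- by rewrite ss2 ?ss1 ?inE //; lia.
by move=> l lb; rewrite ss2 ?ss1 ?inE //; lia.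
Qed.

Lemma wp_search a x n y s : 0 < a -> s a = enc x -> r (x, n) = Some y ->
  (forall m z, r (x, m) = Some z -> z = y) ->
  wp g (search_cmd a) (fun s' => s' a = enc y /\ forall l, 0 < l < a -> s' l = s l) s.
Proof.
move=> a0 sa rn ry; apply: wp_seq; apply: wp_clear.
apply: wp_seq; apply: wp_mono (wp_body (x := x) (n := 0) a0 _ _) _.
- by rewrite updN ?sa //; lia.
- by rewrite updE.
move=> s1 [i1 ss1]; apply: wp_seq.
(* [k] is the distance to the known success [n]; stopping earlier is harmless, as all successes give
   [y]. *)
have W k m s2 : n = k + m -> inv a x m s2 ->
    wp g (While a.+2 (fun s => ~~ is_bit s) (Seq (Push a.+1 true) (body a)))
     (fun s' => s' a.+2 = enc (Some y) /\ forall l, 0 < l < a -> s' l = s2 l) s2; last first.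
  apply: wp_mono (W n 0 _ (esym (addn0 n)) i1) _ => s2 [s2a ss2].
  apply: wp_seq; apply: wp_pop.
  apply: wp_mono (wp_copy _ _ _) _; first by rewrite /= !inE; lia.
  move=> s3 [s3a ss3]; split; first by rewrite s3a updE s2a.
  by move=> l lb; rewrite ss3 ?inE ?updN ?ss2 ?ss1 ?updN //; lia.
elim: k m s2 => [|k IH] m s2 nm [s2a s2n s2r].
  have mn : m = n by lia.
  by apply: wp_while; move: s2r; rewrite mn rn => s2r; rewrite s2r.
apply: wp_while; rewrite s2r; case E: (r (x, m)) => [z|] /=.
  by rewrite (ry _ _ E).
apply: wp_seq; apply: wp_push.
apply: wp_mono (wp_body (x := x) (n := m.+1) a0 _ _) _.
- by rewrite updN ?s2a //; lia.
- by rewrite updE s2n.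
move=> s3 [i3 ss3]; apply: wp_mono (IH m.+1 _ _ i3) _; first by lia.
by move=> s4 [s4a ss4]; split=> // l lb; rewrite ss4 ?ss3 ?updN //; lia.
Qed.

Lemma exec_search a x s s' : 0 < a -> s a = enc x -> exec g (search_cmd a) s s' ->
  exists n, r (x, n) <> None.
Proof.
move=> a0 sa E; inversion E as [| | | |? ? ? s1 ? E1 E2| | | |]; subst.
inversion E1; subst.
inversion E2 as [| | | |? ? ? s2 ? E3 E4| | | |]; subst.
inversion E4 as [| | | |? ? ? s3 ? E5 _| | | |]; subst.
have sa1 : upd s a.+1 [::] a = enc x by rewrite updN ?sa //; lia.
have [i2 _] := wp_exec (wp_body (n := 0) a0 sa1 (updE _ _ _)) E3.
move: i2; move: (0) => n; move eqp : (While _ _ _) E5 => p E5 i2.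
elim: E5 n eqp i2 => // {E1 E2 E3 E4 sa1}.
- move=> i c q t1 t2 t3 _ E1 _ _ IH n eqp [i1 i2 i3]; case: eqp => ei ec eq; subst.
  apply: (IH n.+1) => //.
  inversion E1 as [| | | |? ? ? t4 ? E3 E4| | | |]; subst.
  inversion E3; subst.
  have u1 : upd t1 a.+1 (true :: t1 a.+1) a = enc x by rewrite updN ?i1 //; lia.
  have u2 : upd t1 a.+1 (true :: t1 a.+1) a.+1 = unary n.+1 by rewrite updE i2.
  by have [] := wp_exec (wp_body a0 u1 u2) E4.
- move=> i c q t1 cs n [ei ec _] [_ _ i3]; exists n; move: cs; rewrite -ei -ec i3.
  by case: (r _).
Qed.

End Search.

(** A normal form for partial functions: [F] is the union of the stages of [r], whose successes must
    therefore agree. *)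
Definition searches (X Y : Type) (r : X * nat -> option Y) (F : pfun X Y) :=
  forall x y, F x = Some y <-> exists n, r (x, n) = Some y.

Lemma search_recursive `{cX : code X, cY : code Y} {iX : input X} {oY : output Y}
    {ioX : input_code X} {ooY : output_code Y} A (r : X * nat -> option Y) (F : pfun X Y) :
  rec (char_fun A) r -> searches r F -> partial_recursive_in A F.
Proof.
move=> [e he] rF.
have [|M hM] := @program_outputs _ _ _ _ _ _ _ _ [set char_fun A] (search_cmd e) (fun=> F); last first.
  by exists M; apply: hM.
move=> g a s x -> a0 sa; split=> [y /rF[n rn]|s' /(exec_search he a0 sa)[n]].
  apply: wp_mono (wp_search he a0 sa rn _) _ => [m z rm|s' [] //].
  have Fz : F x = Some z by apply/rF; exists m.
  have : F x = Some y by apply/rF; exists n.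
  by rewrite Fz => -[].
by case E: (r _) => [y|] // _; have /rF -> : exists n, r (x, n) = Some y by exists n.
Qed.

Lemma search_rec `{cX : code X, cY : code Y} g (r : X * nat -> option Y) (F : X -> Y) :
  rec g r -> searches r (fun x => Some (F x)) -> rec g F.
Proof.
move=> [e he] rF; exists (search_cmd e) => a a0 s x sa.
have /rF[n rn] : Some (F x) = Some (F x) by [].
apply: (wp_search he a0 sa rn) => m z rm.
have /rF : exists n, r (x, n) = Some z by exists m.
by case.
Qed.

Lemma rec_total_recursive `{cX : code X, cY : code Y} {iX : input X} {oY : output Y}
    {ioX : input_code X} {ooY : output_code Y} A (F : X -> Y) :
  rec (char_fun A) F -> total_recursive_in A F.
Proof.
move=> hF; apply: (search_recursive (r := fun xn => Some (F xn.1))).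
  by apply: rec_some; apply: (rec_comp hF rec_fst1).
by move=> x y; split=> [<-|[n] //]; exists 0.
Qed.

(** * Simulation with a bounded number of steps *)

Section Run.
Context `{iX : input X, oY : output Y}.

(** Halting configurations are kept, so an answer remains available at all later times and several
    computations can be inspected at a common time. *)
Definition run (M : otm) (g : pfun nat nat) (x : X) (t : nat) : option Y :=
  obind (fun c => if halted c then Some (unload (c.2 (output_tape M))) else None)
    (iter t (obind (fun c => if halted c then Some c else step g c))
       (Some (init M (load x)))).

Variables (M : otm) (g : pfun nat nat) (x : X).

Let stay := obind (fun c : config M => if halted c then Some c else step g c).

Let stay_halted t u c : iter t stay (Some (init M (load x))) = Some c -> halted c -> t <= u ->
  iter u stay (Some (init M (load x))) = Some c.
Proof.
move=> hc hh /subnK <-; elim: (u - t) => //= k ->; by rewrite /= hh.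
Qed.

Lemma run_mono t u y : run M g x t = Some y -> t <= u -> run M g x u = Some y.
Proof.
rewrite /run -/stay; case E: (iter t stay _) => [c|] //=; case: ifP => // hh hy tu.
by rewrite (stay_halted E hh tu) /= hh.
Qed.

Lemma runP y : outputs M g x y <-> exists t, run M g x t = Some y.
Proof.
rewrite /run -/stay; split=> [[t [c [hc hh <-]]]|[t]].
  exists t; have -> : iter t stay (Some (init M (load x))) = Some c; last by rewrite /= hh.
  elim: t c hc {hh} => [|t IH] c //=; case E: (iter t _ _) => [c'|] //=.
  rewrite (IH _ E) /=; case: ifP => // hh.
  by rewrite /step; move: hh; rewrite /halted; case: (prog _).
case E: (iter t stay _) => [c|] //=; case: ifP => // hh [hy].
elim: t c E hh hy => [|t IH] c; first by move=> E hh hy; exists 0, c.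
rewrite iterS; case E: (iter t stay _) => [c'|] //=; case: ifP => [hh [<-] _ hy|hh sc' hc hy].
  exact: IH E hh hy.
exists t.+1, c; split=> //.
have -> : iter t.+1 (obind (step g)) (Some (init M (load x))) =
   step g c'; last by [].
rewrite iterS; have -> : iter t (obind (step g)) (Some (init M (load x))) = Some c'; last by [].
elim: t c' E hh {IH sc'} => [|t IH] c' //=; case E: (iter t stay _) => [c''|] //=.
case: ifP => [hh [<-]|hh sc'']; first by rewrite hh.
by move=> _; rewrite (IH _ E hh).
Qed.

Lemma outputs_fun y y' : outputs M g x y -> outputs M g x y' -> y = y'.
Proof.
move=> /runP[t ht] /runP[u hu].
move: (run_mono ht (leq_addr u t)); rewrite addnC (run_mono hu (leq_addr t u)).
by case.
Qed.
End Run.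

(** The simulated oracle may depend on the parameter [z]: it will be an approximation of the jump at
    some stage, or a finite table. *)
Lemma rec_run `{cX : code X, cY : code Y, cZ : code Z} {iX : input X} {oY : output Y}
    {ioX : input_code X} {ooY : output_code Y} g (M : otm) (o : Z * nat -> option nat)
    (x : Z -> X) (t : Z -> nat) : rec g o -> rec g x -> rec g t ->
  rec g (fun z => run M (fun n => o (z, n)) (x z) (t z) : option Y).
Proof.
move=> ho hx ht; have [n [_ rX _]] := ioX; have [_ rY] := ooY.
have h0 : rec g (fun z => Some (init M (load (x z)))).
  apply: rec_some; apply: rec_pair; first exact: rec_const.
  by apply: rec_ffun => i; apply: rec_tape_of; apply: (rec_comp (rX g i) hx).
have hf : rec g (fun zc : Z * option (config M) =>
    obind (fun c => if halted c then Some c else step (fun n => o (zc.1, n)) c) zc.2).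
  apply: rec_ext (rec_oapp (init M [::]) (f := fun xc : (Z * option (config M)) * config M =>
     if halted xc.2 then Some xc.2 else step (fun n => o (xc.1.1, n)) xc.2)
     rec_snd1 _ (rec_const None)) _; last by move=> [z [c|]].
  apply: rec_if; [exact: (rec_halted rec_snd1)|by rec_tac|].
  apply: (rec_step_config (o := fun xn => o (xn.1.1.1, xn.2))); last exact: rec_snd1.
  by apply: (rec_comp ho); rec_tac.
apply: rec_ext (rec_oapp (init M [::]) (f := fun zc : Z * config M => if halted zc.2 then
   Some (unload (zc.2.2 (output_tape M)) : Y) else None) (rec_iter ht h0 hf) _ (rec_const None)) _.
  apply: rec_if; [exact: (rec_halted rec_snd1)| |exact: rec_const].
  apply: rec_some; apply: (rec_comp (rY g)); apply: rec_app.
  exact: (rec_snd (Y := state M) rec_snd1).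
by move=> z; rewrite /run; case: (iter _ _ _).
Qed.

Lemma rec_char_fun `{cX : code X} A (n : X -> nat) : rec (char_fun A) n ->
  rec (char_fun A) (fun x => `[< A (n x) >]).
Proof.
move=> hn; have H : rec (char_fun A) (fun n => `[< A n >]); last exact: rec_comp H hn.
have L n0 : lead (unary n0) = n0 by elim: n0 => //= n0 ->.
exists (fun a => Seq (copy a.+1 a 0) (Seq Ask (copy a.+1 0 a))) => a a0 r i ra.
have := @transforms_ask (char_fun A) nat unary (fun n => `[< A n >]) (fun=> erefl) a a0 r i ra.
by rewrite /= L.
Qed.

Lemma recursive_search `{cX : code X, cY : code Y} {iX : input X} {oY : output Y}
    {ioX : input_code X} {ooY : output_code Y} A (F : pfun X Y) :
  partial_recursive_in A F -> exists r : X * nat -> option Y,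
    [/\ rec (char_fun A) r, searches r F &
     forall x n m y, r (x, n) = Some y -> n <= m -> r (x, m) = Some y].
Proof.
move=> [M hM]; exists (fun xn => run M (char_fun A) xn.1 xn.2); split.
- apply: (rec_run M (o := fun zn => Some (nat_of_bool `[< A zn.2 >])) _ rec_fst1 rec_snd1).
  by rec_tac; apply: rec_char_fun; rec_tac.
- by move=> x y; rewrite hM; apply: runP.
- by move=> x n m y; apply: run_mono.
Qed.

Lemma total_recursive_rec `{cX : code X, cY : code Y} {iX : input X} {oY : output Y}
    {ioX : input_code X} {ooY : output_code Y} A (F : X -> Y) :
  total_recursive_in A F -> rec (char_fun A) F.
Proof. by move=> /recursive_search[r [hr rF _]]; apply: search_rec hr rF. Qed.

(** * Enumerations, jumps and limits *)

(** Bijective binary numeration, with digits 1 and 2, so that no leading digit is lost. As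
    [size w <= w2n w], the number itself is a sufficient count of rounds of [peel] in [n2w]. *)
Definition w2n (w : word) : nat := foldl (fun n (b : bool) => (n + n + b).+1) 0 w.

Definition peel (nw : nat * word) : nat * word :=
  if nw.1 is m.+1 then (m./2, odd m :: nw.2) else nw.

Definition n2w (n : nat) : word := (iter n peel (n, [::])).2.

Lemma w2nK : cancel w2n n2w.
Proof.
move=> w; rewrite /n2w.
have size_w2n : size w <= w2n w.
  elim/last_ind: w => // w b; rewrite size_rcons /w2n foldl_rcons; lia.
have H k v : size w <= k -> iter k peel (w2n w, v) = (0, w ++ v).
  elim/last_ind: w k v {size_w2n} => [|w b IH] k v.
    by move=> _; elim: k => //= k ->.
  case: k => [|k]; rewrite size_rcons // ltnS => wk.
  rewrite iterSr /w2n foldl_rcons /peel /= -/peel -/(w2n w).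
  have -> : (w2n w + w2n w + b)./2 = w2n w by case: b; lia.
  have -> : odd (w2n w + w2n w + b) = b by case: b; lia.
  by rewrite IH // cat_rcons.
by rewrite H // cats0.
Qed.

Lemma rec_w2n `{cX : code X} g (w : X -> word) : rec g w -> rec g (fun x => w2n (w x)).
Proof.
move=> hw; apply: (rec_foldl_word (f := fun x => (x.2.1 + x.2.1 + x.2.2).+1) (z := fun=> 0)) => //.
  by rec_tac.
exact: rec_const.
Qed.

Lemma rec_n2w `{cX : code X} g (n : X -> nat) : rec g n -> rec g (fun x => n2w (n x)).
Proof.
move=> hn; apply: rec_snd.
have hp : rec g (fun x : X * (nat * word) => peel x.2).
  apply: (rec_ext (f := fun x : X * (nat * word) => if x.2.1 == 0 then x.2 else
    (x.2.1.-1./2, ~~ (x.2.1.-1./2 + x.2.1.-1./2 == x.2.1.-1) :: x.2.2))).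
    by rec_tac; apply: rec_cons; rec_tac.
  by move=> [x [[|m] w]] //=; rewrite /peel /=; congr (_, _ :: _); lia.
by apply: (rec_iter (f := fun x => peel x.2) hn _ hp); rec_tac.
Qed.

Class decodable (X : Type) {cX : code X} : Prop := decodableP :
  exists2 dec : word -> X, cancel enc dec & forall g, rec g dec.
Arguments decodable X {cX}.

#[global] Instance decodable_word : decodable word.
Proof. by exists id => // g; apply: rec_id. Qed.

#[global] Instance decodable_nat : decodable nat.
Proof.
exists size => [n|g]; first exact: size_nseq.
by apply: rec_size; apply: rec_id.
Qed.

#[global] Instance decodable_prod X Y (cX : code X) (cY : code Y) :
  decodable X -> decodable Y -> decodable (X * Y).
Proof.
move=> [dX KX rX] [dY KY rY].
exists (fun w => (dX (fstw w), dY (sndw w))) => [[x y]|g] /=.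
  by rewrite fstwK sndwK KX KY.
apply: rec_pair; [apply: (rec_comp (rX g))|apply: (rec_comp (rY g))].
  by apply: (rec_fstw (h := fun w : word => w) rec_id).
by apply: (rec_sndw (h := fun w : word => w) rec_id).
Qed.

Definition tonat `{cX : code X} (x : X) : nat := w2n (enc x).

Lemma rec_tonat `{cX : code X, cY : code Y} g (x : Y -> X) : rec g x ->
  rec g (fun y => tonat (x y)).
Proof. by move=> hx; apply: rec_w2n; apply: (rec_recode hx). Qed.

Lemma ofnat_ex `{cX : code X} {dX : decodable X} : exists2 d : nat -> X,
  cancel tonat d & forall g, rec g d.
Proof.
have [d dK rd] := dX; exists (fun n => d (n2w n)) => [x|g].
  by rewrite /tonat w2nK dK.
by apply: (rec_comp (rd g)); apply: rec_n2w; apply: rec_id.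
Qed.

Section Enumerations.
Context {I X : Type} {cI : code I} {cX : code X} {iI : input I} {oI : output I} {iX : input X}.
Context {ioI : input_code I} {ooI : output_code I} {ioX : input_code X}.
Variables (A : set nat) (U : pfun (I * X) nat).
Hypothesis accU : acceptable A U.

(** The index function is recursive without [A] even though [b] uses [A]; both r.e. sets and jumps
    are handled by this form. *)
Lemma W_smn (b : I * X * nat -> bool) : rec (char_fun A) b ->
  exists2 phi : I -> I, rec (char_fun set0) phi &
    forall i x, W U (phi i) x <-> exists n, b (i, x, n).
Proof.
move=> hb; have [_ smn] := accU.
pose psi ix := if `[< exists n, b (ix, n) >] then Some 0 else None.
have hpsi : partial_recursive_in A psi.
  apply: (search_recursive (r := fun ixn => if b ixn then Some 0 else None)).
    by rec_tac.
  move=> ix y; rewrite /psi; split=> [|[n]].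
    by case: asboolP => // -[n bn] [<-]; exists n; rewrite bn.
  by case: ifP => // bn [<-]; rewrite asboolT //; exists n.
have [phi [rphi phiE]] := smn _ hpsi.
exists phi; first exact: total_recursive_rec.
move=> i x; rewrite /W /= -phiE /psi; case: asboolP => //.
Qed.

Lemma W_enum : exists b : I * X * nat -> bool, [/\ rec (char_fun A) b,
    forall i x, W U i x <-> exists n, b (i, x, n) &
    forall ix n m, b (ix, n) -> n <= m -> b (ix, m)].
Proof.
have [/recursive_search[r [hr rU rm]] _] := accU.
exists (fun z => isSome (r z)); split; first by rec_tac.
- move=> i x; rewrite /W /=; split=> [|[n]].
    case E: (U _) => [y|] // _; have [n rn] := (rU _ _).1 E.
    by exists n; rewrite rn.
  case E: (r _) => [y|] // _; have -> // : U (i, x) = Some y.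
  by apply/rU; exists n.
- by move=> ix n m; case E: (r _) => [y|] // _ /(rm _ _ _ _ E) ->.
Qed.
End Enumerations.

Section Jump.
Variables (A A' : set nat).
Hypothesis jump : is_jump A A'.

Lemma jump_approx : exists a : nat * nat -> bool, [/\ rec (char_fun A) a,
  forall e, A' e <-> exists s, a (e, s) & forall e s t, a (e, s) -> s <= t -> a (e, t)].
Proof.
have [U accU ->] := jump; have [b [hb bU bm]] := W_enum accU.
exists (fun es => b (es.1, es.1, es.2)); split.
- by apply: (rec_comp hb); rec_tac.
- by move=> e; apply: bU.
- by move=> e s t; apply: bm.
Qed.

Lemma jump_decide `{cX : code X} {dX : decodable X} (b : X * nat -> bool) :
  rec (char_fun A) b -> rec (char_fun A') (fun x => `[< exists n, b (x, n) >]).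
Proof.
move=> hb; have [U accU A'E] := jump; have [d dK rd] := ofnat_ex.
(* The second argument is ignored, so the set with index [phi e] is either everything or empty, and
   the diagonal question whether it contains its own index is the existential question asked. *)
have [|phi rphi phiE] := W_smn accU (b := fun z => b (d z.1.1, z.2)).
  by apply: (rec_comp hb); rec_tac; apply: (rec_comp (rd _)); rec_tac.
apply: rec_ext (rec_char_fun (n := fun x => phi (tonat x)) _) _ => [|x].
  by apply: (rec_comp (rec_strip _ rphi)); apply: rec_tonat; apply: rec_id.
by apply: asbool_equiv_eq; rewrite A'E; apply: iff_trans (phiE _ _) _; rewrite /= dK.
Qed.

(* Run the machine with the finite approximations of the jump as oracles. *)
Lemma jump_limit `{cX : code X} {iX : input X} {ioX : input_code X} (F : X -> nat) :
  rec (char_fun A') F -> exists2 d : X * nat -> nat, rec (char_fun A) d &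
    forall x, exists s0, forall s, s0 <= s -> d (x, s) = F x.
Proof.
move=> /rec_total_recursive[M hM]; have [a [ha aA am]] := jump_approx.
pose o s : pfun nat nat := fun n => Some (nat_of_bool (a (n, s))).
exists (fun xs => odflt 0 (run M (o xs.2) xs.1 xs.2)).
  apply: rec_odflt; by apply: (rec_run M (o := fun zn => o zn.1.2 zn.2)); rewrite /o; rec_tac.
move=> x; have /runP[t ht] : outputs M (char_fun A') x (F x) by apply/hM.
have oP n : exists s0, forall s, s0 <= s -> o s n = char_fun A' n.
  rewrite /o /char_fun; case: asboolP => [/aA[s0 hs]|nA].
    by exists s0 => s /(am _ _ _ hs) ->.
  by exists 0 => s _; case E: (a _) => //; case: nA; apply/aA; exists s.
pose stay g := obind (fun c : config M => if halted c then Some c else step g c).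
(* The first [t] steps make finitely many queries, and from some stage on all of them are answered
   correctly. *)
have [s0 hs] : exists s0, forall s, s0 <= s ->
    iter t (stay (o s)) (Some (init M (load x))) =
    iter t (stay (char_fun A')) (Some (init M (load x))).
  elim: t {ht} => [|t [s1 IH]]; first by exists 0.
  rewrite iterS; case E: (iter t (stay (char_fun A')) _) => [c|]; last first.
    by exists s1 => s hs; rewrite iterS (IH s hs) E.
  have [s2 hs2] := oP (read_nat (c.2 (query_tape M))).
  exists (maxn s1 s2) => s; rewrite geq_max => /andP[hs1 /hs2 os].
  by rewrite iterS (IH s hs1) E /= /step os.
exists (maxn t s0) => s; rewrite geq_max => /andP[ts ss].
have -> : run M (o s) x s = Some (F x); last by [].
by apply: run_mono _ ts; rewrite -ht /run -!/(stay _) hs.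
Qed.
End Jump.

Definition npair (p : nat * nat) : nat := tonat p.

Lemma npair_surj : exists2 d : nat -> nat * nat, cancel npair d & forall g, rec g d.
Proof. exact: ofnat_ex. Qed.

Lemma rec_npair `{cX : code X} g (p : X -> nat * nat) : rec g p ->
  rec g (fun x => npair (p x)).
Proof. exact: rec_tonat. Qed.

(** * Cardinals, indices and maxima *)

Section Counting.
Local Open Scope classical_set_scope.
Local Open Scope card_scope.

Lemma option_ext T (a b : option T) : (forall x, a = Some x <-> b = Some x) -> a = b.
Proof.
move=> ab; case: a ab => [x|] ab; first by rewrite (ab x).1.
by case: b ab => // y /(_ y)[_ ->].
Qed.

Lemma the_natP (P : set nat) n : (forall i j, P i -> P j -> i = j) ->
  the_nat P = Some n <-> P n.
Proof.
move=> uP; rewrite /the_nat; split.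
  by case: xgetP => [y -> [m Pm <-] [<-]|_].
move=> Pn; case: xgetP => [y -> [m Pm <-]|]; first by rewrite (uP _ _ Pm Pn).
by move=> /(_ (Some n)) []; exists n.
Qed.

Lemma pcardP T (Y : set T) n : pcard Y = Some n <-> Y #= `I_n.
Proof.
apply: the_natP => i j /=; rewrite card_eq_sym => Yi Yj.
by apply/card_eq_II; apply: card_eq_trans Yi Yj.
Qed.

Lemma pmaxP h m : pmax h = Some m <-> (exists t, h t = m) /\ forall t, h t <= m.
Proof.
apply: the_natP => i j [[t <-] ti] [[u <-] uj]; apply/eqP.
by rewrite eqn_leq ti uj.
Qed.

Lemma pmax_bounded h b : (forall t, h t <= b) -> exists m, pmax h = Some m.
Proof.
elim: b => [|b IH] hb.
  by exists 0; apply/pmaxP; split=> //; exists 0; apply/eqP; rewrite -leqn0.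
have [[t ht]|hn] := pselect (exists t, h t = b.+1).
  by exists b.+1; apply/pmaxP; split=> //; exists t.
apply: IH => t; rewrite -ltnS ltn_neqAle hb andbT.
by apply/eqP => ht; apply: hn; exists t.
Qed.

Lemma pmax_mono h s m : (forall t u, t <= u -> h t <= h u) ->
  (forall t, s <= t -> h t = m) -> pmax h = Some m.
Proof.
move=> hm hs; apply/pmaxP; split=> [|t]; first by exists s; apply: hs.
by rewrite -(hs _ (leq_maxr t s)); apply: hm; apply: leq_maxl.
Qed.

Lemma card_seq (T : eqType) (s : seq T) : uniq s -> [set` s] #= `I_(size s).
Proof.
elim: s => [_|x s IH /= /andP[xs /IH us]]; first by rewrite set_nil II0 card_eq00.
apply/eq_cardSP; exists x; first by rewrite /= mem_head.
rewrite (_ : _ `\ x = [set` s]) //; apply/seteqP; split=> y /=.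
  by case; rewrite in_cons => /orP[/eqP|].
by move=> ys; rewrite in_cons ys orbT; split => // yx; rewrite -yx ys in xs.
Qed.

(** The set is an initial segment of the numbers, bounded exactly when [h] is, and then its length
    is the largest value. *)
Lemma pcard_pmax h : pcard [set x | exists t, x < h t] = pmax h.
Proof.
apply: option_ext => m; split=> [/pcardP hc|/pmaxP[[t <-] ht]].
  have hb t : h t <= m.
    rewrite -card_le_II -(card_le_eqr hc); apply: subset_card_le => x xt.
    by exists t.
  have [n hn] := pmax_bounded hb; rewrite hn; congr Some.
  have /pmaxP[[t ht] hu] := hn; apply/card_eq_II; rewrite -(card_eqr hc).
  rewrite (_ : [set x | _] = `I_n) ?card_eqxx //; apply/seteqP; split=> x /=.
    by case=> u xu; apply: leq_trans xu (hu u).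
  by move=> xn; exists t; rewrite ht.
apply/pcardP; rewrite (_ : [set x | _] = `I_(h t)) ?card_eqxx //.
apply/seteqP; split=> x /=; last by move=> xt; exists t.
by case=> u xu; apply: leq_trans xu (ht u).
Qed.

Lemma pmax_count (b : nat -> nat -> bool) :
  (forall x t u, b x t -> t <= u -> b x u) ->
  pmax (fun t => \sum_(x < t) b x t) = pcard [set x | exists t, b x t].
Proof.
move=> bm; set S := [set x | _].
pose s t := [seq x <- iota 0 t | b x t].
have sE t : \sum_(x < t) b x t = size (s t).
  rewrite size_filter -sum1_count -(big_mkord xpredT (fun x => nat_of_bool (b x t))).
  rewrite [RHS]big_mkcond /index_iota subn0.
  by apply: eq_bigr => i _; case: (b i t).
have us t : uniq (s t) by rewrite filter_uniq // iota_uniq.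
have sS t x : x \in s t -> S x by rewrite mem_filter => /andP[? _]; exists t.
have Ss x : S x -> exists t, forall u, t <= u -> x \in s u.
  case=> t xt; exists (maxn t x.+1) => u; rewrite geq_max => /andP[tu xu].
  by rewrite mem_filter mem_iota /= add0n xu (bm _ _ _ xt tu).
apply: option_ext => m; split=> [/pmaxP[[t ht] hu]|/pcardP Sm].
  apply/pcardP; rewrite (_ : S = [set` s t]); first by rewrite -ht sE card_seq.
  apply/seteqP; split=> x /=; last exact: sS.
  move=> /Ss[u xu]; case: (boolP (x \in s t)) => // xs.
  (* An element missing from [s t] would be listed later besides all those of [s t], and the count
     would exceed the maximum. *)
  have := hu (maxn u t); rewrite -ht !sE leqNgt => /negP[].
  have : uniq (x :: s t) by rewrite /= xs us.
  move=> /uniq_leq_size; apply=> y; rewrite in_cons => /orP[/eqP->|].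
    exact/xu/leq_maxl.
  rewrite !mem_filter !mem_iota /= !add0n => /andP[yt yl].
  by rewrite (bm _ _ _ yt (leq_maxr _ _)) (leq_trans yl (leq_maxr _ _)).
have le t : \sum_(x < t) b x t <= m.
  rewrite sE -card_le_II -(card_le_eqr Sm) -(card_le_eql (card_seq (us t))).
  by apply: subset_card_le => x; apply: sS.
have [n hn] := pmax_bounded le; rewrite hn; congr Some.
have /pmaxP[[t ht] hu] := hn.
have [r ur Sr] : exists2 r : seq nat, uniq r & S = [set` r].
  have /finite_seqP[r ->] : finite_set S by apply/finite_setP; exists m.
  exists (undup r); first exact: undup_uniq.
  by apply/seteqP; split=> x /=; rewrite mem_undup.
have -> : m = size r.
  by apply/card_eq_II; rewrite -(card_eql Sm) Sr card_seq.
apply/eqP; rewrite eqn_leq; apply/andP; split.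
  rewrite -ht sE; apply: uniq_leq_size => // x /sS.
  by rewrite Sr.
have [u hru] : exists u, {subset r <= s u}.
  have : forall x, x \in r -> S x by rewrite Sr.
  elim: (r) => [|x q IH] rS; first by exists 0.
  have [|u qu] := IH; first by move=> y yq; apply: rS; rewrite in_cons yq orbT.
  have [v xv] := Ss _ (rS x (mem_head _ _)).
  exists (maxn u v) => y; rewrite in_cons => /orP[/eqP->|/qu].
    exact/xv/leq_maxr.
  rewrite !mem_filter !mem_iota /= !add0n => /andP[yt yl].
  by rewrite (bm _ _ _ yt (leq_maxl _ _)) (leq_trans yl (leq_maxl _ _)).
by apply: leq_trans (hu u); rewrite sE; apply: uniq_leq_size.
Qed.

Lemma pcard_image T U (g : T -> U) (S : set T) : {in S &, injective g} ->
  pcard (g @` S) = pcard S.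
Proof.
move=> gi; apply: option_ext => n; split=> /pcardP e; apply/pcardP.
  by rewrite -(card_eql (inj_card_eq gi)).
by rewrite (card_eql (inj_card_eq gi)).
Qed.

(** [eq_cardSP] removes some element [y], not necessarily [x]. Replacing [y] by [x] shows that what
    remains is equipotent to [S] in any case. *)
Lemma pcard_setU1 T (x : T) (S : set T) : ~ S x -> pcard (x |` S) = omap succn (pcard S).
Proof.
move=> xS; have swap y : (x |` S) y -> (x |` S) `\ y #= S.
  move=> Sy; pose g z := if `[< z = y >] then x else z.
  have gi : {in S &, injective g}.
    move=> z t /set_mem Sz /set_mem St; rewrite /g.
    case: asboolP => [->|zy]; case: asboolP => [->|ty] // e.
      by case: xS; rewrite e.
    by case: xS; rewrite -e.
  rewrite (_ : _ `\ y = g @` S); first exact: inj_card_eq gi.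
  apply/seteqP; split=> z /=.
    case=> -[->|Sz] zy; last by exists z => //; rewrite /g asboolF.
    by case: Sy => [yx|Sy]; [case: zy|exists y => //; rewrite /g asboolT].
  case=> t St; rewrite /g; case: asboolP => [ty <-|ty <-].
    by split; [left|move=> xy; case: xS; rewrite xy -ty].
  by split=> //; right.
apply: option_ext => -[|n]; split.
- by move=> /pcardP; rewrite II0 card_eq0 => /eqP e; have : set0 x by rewrite -e; left.
- by case: (pcard S).
- move=> /pcardP/eq_cardSP[y Sy e]; suff -> : pcard S = Some n by [].
  by apply/pcardP; rewrite -(card_eql (swap _ Sy)).
- case E: (pcard S) => [m|] //= [<-]; apply/pcardP/eq_cardSP.
  exists x; first by left.
  by rewrite (card_eql (swap _ _)) ; [apply/pcardP|left].
Qed.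

(** One number per class: counting classes becomes counting elements of a set of numbers, to which
    the results on cardinals apply. *)
Definition least_reps (rho : set (nat * nat)) : set nat :=
  [set x | rho (x, x) /\ forall y, y < x -> ~ rho (y, x)].

(** A symmetric and transitive relation is an equivalence relation on the set of its reflexive
    points, so no domain has to be given; together with [pindex_none] all relations are covered. *)
Lemma pindexE (rho : set (nat * nat)) :
  (forall x y, rho (x, y) -> rho (y, x)) ->
  (forall x y z, rho (x, y) -> rho (y, z) -> rho (x, z)) ->
  pindex rho = pcard (least_reps rho).
Proof.
move=> sy tr.
have refl x y : rho (x, y) -> rho (x, x) by move=> xy; apply: tr (sy _ _ xy).
have key D : equivalence_on D rho -> classes D rho #= least_reps rho.
  move=> [dom re _ _]; pose cl x := [set y | rho (x, y)].
  have -> : classes D rho = cl @` least_reps rho.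
    apply/seteqP; split=> c [x]; last first.
      by move=> [xx _] <-; exists x => //; have [] := dom _ _ xx.
    move=> /re xx <-.
    have : exists y, `[< rho (y, x) >] by exists x; apply/asboolP.
    move=> /ex_minnP[y /asboolP yx ymin]; exists y.
      split; first exact: refl yx.
      move=> z zy /tr /(_ yx)/asboolP/ymin; rewrite leqNgt => /negP[] //.
    apply/seteqP; split=> z /=; first by apply: tr; apply: sy.
    exact: tr yx.
  apply: inj_card_eq => x y /set_mem[xx xm] /set_mem[yy ym] xy.
  have xy' : rho (x, y) by have : cl y y by []; rewrite -[cl y y]/(cl y y) -xy.
  case: (ltngtP x y) => // [xl|yl]; first by case: (ym _ xl).
  by case: (xm _ yl); apply: sy.
have eqD : equivalence_on [set x | rho (x, x)] rho.
  by split=> // x y xy; split; [apply: refl xy|apply: refl (sy _ _ xy)].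
have E n : (exists2 D, equivalence_on D rho & classes D rho #= `I_n) <->
    least_reps rho #= `I_n.
  split=> [[D /key e]|e]; first by rewrite (card_eql e).
  by exists [set x | rho (x, x)] => //; rewrite (card_eql (key _ eqD)).
rewrite /pindex /pcard; congr the_nat; apply/seteqP; split=> n /=; apply E.
Qed.

Lemma pindex_none (rho : set (nat * nat)) :
  ~ ((forall x y, rho (x, y) -> rho (y, x)) /\
     (forall x y z, rho (x, y) -> rho (y, z) -> rho (x, z))) -> pindex rho = None.
Proof.
move=> ne; rewrite /pindex /the_nat; case: xgetP => // y _ [n [D [_ _ sy tr] _] _].
by case: ne.
Qed.

End Counting.

Section Card.
Local Open Scope classical_set_scope.
Variables (U : pfun (word * nat) nat).
Hypothesis accU : acceptable set0 U.

Lemma card_of_max (h : word * nat -> nat) : rec (char_fun set0) h ->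
  exists2 phi : word -> word, total_recursive phi &
    forall p, pcard (W U (phi p)) = pmax (fun t => h (p, t)).
Proof.
move=> hh.
have [|phi rphi phiE] := W_smn accU (b := fun z => z.1.2 < h (z.1.1, z.2)).
  by rec_tac.
exists phi => [|p]; first exact: rec_total_recursive.
by rewrite -pcard_pmax; congr pcard; apply/seteqP; split=> x; apply phiE.
Qed.

Lemma max_of_card (phi : word -> word) : total_recursive phi ->
  exists2 h : word * nat -> nat, rec (char_fun set0) h &
    forall p, pmax (fun t => h (p, t)) = pcard (W U (phi p)).
Proof.
move=> /total_recursive_rec rphi; have [b [hb bU bm]] := W_enum accU.
exists (fun pt => \sum_(x < pt.2) b (phi pt.1, x : nat, pt.2)).
  apply: (rec_sum (f := fun z => nat_of_bool (b (phi z.1.1, z.2, z.1.2)))); rec_tac.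
move=> p; rewrite (@pmax_count (fun x t => b (phi p, x, t))).
  by congr pcard; apply/seteqP; split=> x; apply bU.
by move=> x t u; apply: bm.
Qed.
End Card.

(** * Indices of r.e. equivalence relations *)

Section Index.
Local Open Scope classical_set_scope.
Variables (U : pfun (word * (nat * nat)) nat).
Hypothesis accU : acceptable set0 U.

Section Sigma2.
Variable (Q : word * nat * nat * nat -> bool).
Hypothesis hQ : rec (char_fun set0) Q.

Let S p := [set x | exists a, forall b, Q (p, x, a, b)].

Let refuted p x k n := all (fun a => has (fun b => ~~ Q (p, x, a, b)) (iota 0 n)) (iota 0 k).

Let refuted_mono p x k n m : refuted p x k n -> n <= m -> refuted p x k m.
Proof.
move=> /allP h nm; apply/allP => a /h /hasP[b]; rewrite mem_iota /= add0n => bn Qb.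
by apply/hasP; exists b => //; rewrite mem_iota /= add0n (leq_trans bn nm).
Qed.

Let refutedP p x k : (exists n, refuted p x k n) <->
  forall a, a < k -> exists b, ~~ Q (p, x, a, b).
Proof.
split=> [[n /allP h] a ak|].
  have /h/hasP[b _ Qb] : a \in iota 0 k by rewrite mem_iota.
  by exists b.
elim: k => [|k IH] h; first by exists 0.
have [n hn] : exists n, refuted p x k n by apply: IH => a ak; apply: h; apply: ltnW.
have [b Qb] := h k (ltnSn k); exists (maxn n b.+1).
rewrite /refuted -[k.+1]addn1 iotaD all_cat /= andbT; apply/andP; split.
  by apply: refuted_mono hn _; apply: leq_maxl.
by apply/hasP; exists b => //; rewrite mem_iota /= add0n leq_maxr.
Qed.

(* The relation has a class of rejected elements, containing 0 and the numbers
   that are not the successor of a code.  The code of [(x, a)] enters the domain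
   once all the witnesses before [a] are refuted, and is rejected once [a] is
   refuted as well: the code of [x] with its least true witness survives. *)
Lemma index_sigma2 : exists2 phi : word -> word, total_recursive phi &
  forall p, pindex (W U (phi p)) = omap succn (pcard (S p)).
Proof.
have [d dK rd] := npair_surj.
(* [j = 0] stands for entering the domain and [j = 1] for being rejected: by stage [n] the witnesses
   below [(d u.-1).2 + j] are refuted. Both hold at once for 0 and for numbers that come from no
   code. *)
pose entered j p (u n : nat) := if u == 0 then true else
  (npair (d u.-1) == u.-1) ==> refuted p (d u.-1).1 ((d u.-1).2 + j) n.
have rentered j Z (cZ : code Z) (p : Z -> word) (u n : Z -> nat) :
    rec (char_fun set0) p -> rec (char_fun set0) u -> rec (char_fun set0) n ->
    rec (char_fun set0) (fun z => entered j (p z) (u z) (n z)).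
  move=> hp hu hn.
  have hd : rec (char_fun set0) (fun z => d (u z).-1).
    by apply: (rec_comp (rd _)); rec_tac.
  rewrite /entered; rec_tac; first by apply: rec_npair.
  apply: (rec_all (f := fun zi => has (fun b => ~~ Q (p zi.1, (d (u zi.1).-1).1, zi.2, b))
     (iota 0 (n zi.1)))); rec_tac.
  apply: (rec_has (f := fun zb => ~~ Q (p zb.1.1, (d (u zb.1.1).-1).1, zb.1.2, zb.2))); rec_tac.
  exact: (rec_comp hd (rec_fst rec_fst1)).
pose E j p u := exists n, entered j p u n.
have entered_mono j p u n m : entered j p u n -> n <= m -> entered j p u m.
  rewrite /entered; case: eqP => // _; case: eqP => //= _; exact: refuted_mono.
have E10 p u : E 1 p u -> E 0 p u.
  case=> n; rewrite /E /entered; case: eqP => // _; case: eqP => //= _ h.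
  have [m hm] : exists m, refuted p (d u.-1).1 ((d u.-1).2 + 0) m.
    apply/refutedP => a ak.
    by apply: ((refutedP p (d u.-1).1 ((d u.-1).2 + 1)).1 _ a); [exists n|lia].
  by exists m.
have [|phi rphi phiE] := W_smn accU (b := fun z : word * (nat * nat) * nat =>
    (z.1.2.1 == z.1.2.2) && entered 0 z.1.1 z.1.2.1 z.2 ||
    entered 1 z.1.1 z.1.2.1 z.2 && entered 1 z.1.1 z.1.2.2 z.2).
  by rec_tac; apply: rentered; rec_tac.
exists phi => [|p]; first exact: rec_total_recursive.
(* The diagonal of the entered elements together with the square of the rejected ones: a survivor is
   alone in its class. *)
have WE u v : W U (phi p) (u, v) <-> (u = v /\ E 0 p u) \/ (E 1 p u /\ E 1 p v).
  rewrite phiE /=; split=> [[n /orP[/andP[/eqP-> h]|/andP[h h']]]|[[<- [n h]]|[[n h] [m h']]]].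
  - by left; split=> //; exists n.
  - by right; split; exists n.
  - by exists n; rewrite eqxx h.
  - exists (maxn n m); rewrite (entered_mono _ _ _ _ _ h (leq_maxl _ _)).
    by rewrite (entered_mono _ _ _ _ _ h' (leq_maxr _ _)) orbT.
rewrite pindexE; first last.
- move=> x y z /WE[[<- _] //|[hx hy]] /WE[[<- _]|[_ hz]]; apply/WE; by right.
- by move=> x y /WE[[<- h]|[h h']]; apply/WE; [left|right].
have E1_0 : E 1 p 0 by exists 0.
(* The survivors. The rejected class contains 0, hence has 0 as its least element; it accounts for
   the [succn]. *)
pose T := [set u | E 0 p u /\ ~ E 1 p u].
have -> : least_reps (W U (phi p)) = 0 |` T.
  apply/seteqP; split=> u /=.
    case=> /WE uu um; have [->|u0] := eqVneq u 0; first by left.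
    right; have nu : ~ E 1 p u.
      by move=> hu; apply: (um 0); [rewrite lt0n|apply/WE; right].
    by split=> //; case: uu => [[]|[]].
  case=> [->|[hu nu]]; first by split=> //; apply/WE; right.
  split=> [|y yu]; first by apply/WE; left.
  by move=> /WE[[yu' _]|[_]//]; rewrite yu' ltnn in yu.
rewrite pcard_setU1; last by case.
have TP u : T u -> [/\ u = (npair (d u.-1)).+1,
    forall a, a < (d u.-1).2 -> exists b, ~~ Q (p, (d u.-1).1, a, b) &
    forall b, Q (p, (d u.-1).1, (d u.-1).2, b)].
  rewrite /T /E /entered /=; case: u => [|u]; first by case=> _ []; exists 0.
  rewrite /=; case: eqP => [uE|_] /=; last by case=> _ []; exists 0.
  rewrite uE addn0 => -[/refutedP h nh]; split=> // b.
  apply/negPn/negP => Qb; apply: nh; apply/refutedP => a.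
  rewrite addn1 ltnS leq_eqVlt => /orP[/eqP->|/h //].
  by exists b.
have TQ x a : (forall a', a' < a -> exists b, ~~ Q (p, x, a', b)) ->
    (forall b, Q (p, x, a, b)) -> T (npair (x, a)).+1.
  move=> ha hQa; rewrite /T /E /entered /= dK eqxx /= addn0; split; first exact/refutedP.
  by move=> /refutedP/(_ a)[|b]; rewrite ?addn1 // hQa.
(* Forgetting the witness is injective on survivors, since a true witness preceded only by refuted
   ones is unique. *)
congr omap; rewrite -(@pcard_image _ _ (fun u => (d u.-1).1) T).
  congr pcard; apply/seteqP; split=> x.
    by case=> u /TP[_ _ hb] <-; exists (d u.-1).2.
  case=> a0 ha0.
  have : exists a, `[< forall b, Q (p, x, a, b) >] by exists a0; apply/asboolP.
  move=> /ex_minnP[a /asboolP ha am]; exists (npair (x, a)).+1 => /=; last by rewrite dK.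
  apply: TQ => // a' a'a; apply: contrapT => nb.
  have /am : `[< forall b, Q (p, x, a', b) >].
    by apply/asboolP => b; apply/negPn/negP => nQ; apply: nb; exists b.
  by rewrite leqNgt a'a.
move=> u v /set_mem/TP[uE hu Qu] /set_mem/TP[vE hv Qv] xuv.
rewrite uE vE; congr (npair _).+1.
move: hu Qu hv Qv xuv; case: (d u.-1) (d v.-1) => [x a] [y b] /= hu Qu hv Qv xy.
rewrite -xy in hv Qv *; congr (_, _).
by case: (ltngtP a b) => // [/hv|/hu] [c]; rewrite ?Qu ?Qv.
Qed.
End Sigma2.

Lemma index_of_max (J : set nat) (h : word * nat -> nat) : is_jump set0 J ->
  rec (char_fun J) h -> exists2 phi : word -> word, total_recursive phi &
    forall p, pindex (W U (phi p)) = omap succn (pmax (fun t => h (p, t))).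
Proof.
move=> hJ /(jump_limit hJ)[e he eh].
have [d dK rd] := npair_surj.
(* A witness codes a [t] together with a stage from which the approximations of [h (p, t)] exceed
   [x]; as they are eventually constant, this says that [x < h (p, t)]. *)
pose Q (z : word * nat * nat * nat) :=
  ((d z.1.2).2 <= z.2) ==> (z.1.1.2 < e ((z.1.1.1, (d z.1.2).1), z.2)).
have hQ : rec (char_fun set0) Q.
  have hd : rec (char_fun set0) (fun z : word * nat * nat * nat => d z.1.2).
    by apply: (rec_comp (rd _)); rec_tac.
  by rewrite /Q; rec_tac.
have [phi rphi phiE] := index_sigma2 hQ; exists phi => // p.
rewrite phiE -pcard_pmax; congr (omap _ (pcard _)); apply/seteqP; split=> x /=.
  case=> a ha; exists (d a).1; have [s0 hs] := eh (p, (d a).1).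
  have := ha (maxn s0 (d a).2).
  by rewrite /Q /= leq_maxr /= hs // leq_maxl.
case=> t xt; have [s0 hs] := eh (p, t); exists (npair (t, s0)) => b.
by rewrite /Q /= dK /=; apply/implyP => sb; rewrite hs.
Qed.

Lemma max_of_index (J : set nat) (phi : word -> word) : is_jump set0 J ->
  total_recursive phi -> exists2 h : word * nat -> nat, rec (char_fun J) h &
    forall p, pmax (fun t => h (p, t)) = pindex (W U (phi p)).
Proof.
move=> hJ /total_recursive_rec rphi; have [b [hb bU bm]] := W_enum accU.
pose R p x y := `[< exists n, b (phi p, (x, y), n) >].
have RE p x y : R p x y <-> W U (phi p) (x, y).
  by rewrite bU; split=> /asboolP.
have hR : rec (char_fun J) (fun z : word * (nat * nat) => R z.1 z.2.1 z.2.2).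
  apply: rec_ext (jump_decide hJ (b := fun z : word * (nat * nat) * nat =>
    b (phi z.1.1, z.1.2, z.2)) _) _; first by rec_tac.
  by case=> p [x y].
have rR Z (cZ : code Z) (p : Z -> word) (x y : Z -> nat) : rec (char_fun J) p ->
   rec (char_fun J) x -> rec (char_fun J) y -> rec (char_fun J) (fun z => R (p z) (x z) (y z)).
  by move=> hp hx hy; apply: (rec_comp hR (rec_pair hp (rec_pair hx hy))).
pose bad3 p x y z := R p x y && (~~ R p y x || R p y z && ~~ R p x z).
pose bad p t := has (fun x => has (fun y => has (bad3 p x y) (iota 0 t)) (iota 0 t)) (iota 0 t).
pose rep p x := R p x x && all (fun y => ~~ R p y x) (iota 0 x).
(* Once a failure of symmetry or transitivity occurs below [t], the value is [t] itself: the
   sequence becomes unbounded and its maximum undefined, as the index is. *)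
exists (fun pt => if bad pt.1 pt.2 then pt.2 else \sum_(x < pt.2) rep pt.1 x).
  apply: rec_if; [|rec_tac|].
    apply: (rec_has (f := fun z => has (fun y => has (bad3 z.1.1 z.2 y) (iota 0 z.1.2))
      (iota 0 z.1.2))); rec_tac.
    apply: (rec_has (f := fun z => has (bad3 z.1.1.1 z.1.2 z.2) (iota 0 z.1.1.2))); rec_tac.
    apply: (rec_has (f := fun z => bad3 z.1.1.1.1 z.1.1.2 z.1.2 z.2)); rec_tac.
    by rewrite /bad3; rec_tac; apply: rR; rec_tac.
  apply: (rec_sum (f := fun z => nat_of_bool (rep z.1.1 z.2))); rec_tac.
  rewrite /rep; rec_tac; first by apply: rR; rec_tac.
  apply: (rec_all (f := fun z => ~~ R z.1.1.1 z.2 z.1.2)); rec_tac.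
  by apply: rR; rec_tac.
move=> p /=.
have badP t : bad p t <-> exists x y z, [/\ x < t, y < t, z < t & bad3 p x y z].
  split=> [/hasP[x xt /hasP[y yt /hasP[z zt h]]]|[x [y [z [xt yt zt h]]]]].
    by exists x, y, z; move: xt yt zt; rewrite !mem_iota.
  apply/hasP; exists x; first by rewrite mem_iota.
  apply/hasP; exists y; first by rewrite mem_iota.
  by apply/hasP; exists z; first by rewrite mem_iota.
have [[x [y [z xyz]]]|good] := pselect (exists x y z, bad3 p x y z).
  rewrite pindex_none.
    apply: option_ext => m; split=> // /pmaxP[_ hm].
    have := hm (maxn m.+1 (maxn x.+1 (maxn y.+1 z.+1))).
    rewrite (_ : bad _ _); last by apply/badP; exists x, y, z; split=> //; lia.
    by lia.
  move=> [sy tr]; move: xyz => /andP[/RE xy /orP[/negP h|/andP[/RE yz /negP h]]].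
    by apply: h; apply/RE; apply: sy.
  by apply: h; apply/RE; apply: tr yz.
have nb t : bad p t = false by apply/negP => /badP[x [y [z [_ _ _ ?]]]]; apply: good; exists x, y, z.
have sy x y : W U (phi p) (x, y) -> W U (phi p) (y, x).
  move=> /RE xy; apply/RE/negPn/negP => yx; apply: good.
  by exists x, y, x; rewrite /bad3 xy yx.
have tr x y z : W U (phi p) (x, y) -> W U (phi p) (y, z) -> W U (phi p) (x, z).
  move=> /RE xy /RE yz; apply/RE/negPn/negP => xz; apply: good.
  by exists x, y, z; rewrite /bad3 xy yz xz orbT.
rewrite pindexE // (_ : (fun t => _) = fun t => \sum_(x < t) rep p x); last first.
  by apply: funext => t; rewrite nb.
rewrite (@pmax_count (fun x _ => rep p x)) //; congr pcard; apply/seteqP.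
split=> x /=.
  case=> _ /andP[/RE xx /allP h]; split=> // y yx /RE xy.
  by have := h y; rewrite mem_iota yx xy => /(_ isT).
case=> xx h; exists 0; apply/andP; split; first exact/RE.
by apply/allP => y; rewrite mem_iota /= => yx; apply/negP => /RE; apply: h.
Qed.
End Index.

(** * Differences of maxima *)

Section Differences.
Variables (A A' : set nat).
Hypothesis jump : is_jump A A'.

Lemma search_pmax (h : word * nat -> nat) : rec (char_fun A) h ->
  exists2 r : word * nat -> option nat, rec (char_fun A') r &
    searches r (fun p => pmax (fun t => h (p, t))).
Proof.
move=> hh; pose c (z : word * nat) := `[< exists t, z.2 < h (z.1, t) >].
have hc : rec (char_fun A') c.
  apply: rec_ext (jump_decide jump (b := fun z : word * nat * nat =>
    z.1.2 < h (z.1.1, z.2)) _) _; first by rec_tac.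
  by [].
(* The maximum is the [n] that no value exceeds while some value exceeds [n.-1]; for 0 the first
   condition already forces all values to be 0. *)
exists (fun z => if ~~ c z && ((z.2 == 0) || c (z.1, z.2.-1)) then Some z.2 else None).
  by rec_tac.
move=> p y; rewrite pmaxP; split=> [[[t ty] hy]|[n]].
  exists y; rewrite /c /= asboolF => [|[u]]; last by rewrite ltnNge hy.
  case: y ty hy => //= y ty _; rewrite asboolT //.
  by exists t; rewrite ty.
case: ifP => //= /andP[/asboolP nc cn] [<-]; split; last first.
  by move=> t; rewrite leqNgt; apply/negP => nt; apply: nc; exists t.
case: n nc cn => [|n] nc /=.
  move=> _; exists 0; apply/eqP; rewrite -leqn0 leqNgt; apply/negP => nt.
  by apply: nc; exists 0.
move=> /asboolP[t /= nt]; exists t; apply/eqP; rewrite eqn_leq nt andbT leqNgt.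
by apply/negP => nt'; apply: nc; exists t.
Qed.

(** Bounded minimization, in a form to which [rec_iter] applies; the value is [s] when nothing below
    [s] satisfies [P]. *)
Let first (P : nat -> bool) (s : nat) := iter s (fun k => if P k then k else k.+1) 0.

Let firstP P s : [/\ first P s <= s, forall j, j < first P s -> ~~ P j &
  first P s < s -> P (first P s)].
Proof.
elim: s => [|s [h1 h2 h3]]; first by split.
rewrite /first iterS -/(first P s); case: ifPn => hP; split=> //.
- exact: leqW.
- by move=> j; rewrite ltnS leq_eqVlt => /orP[/eqP->|/h2].
- by rewrite ltnS => /h3; rewrite (negbTE hP).
Qed.

(* The guess [v (x, s)] at stage [s] comes from the first computation length
   that the approximation of [A'] accepts; each revision of the guess increases
   [m2] by more than the guess, so that [m1 = m2 + guess] is increasing too. *)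
Lemma partial_diff (f : pfun word nat) : partial_recursive_in A' f ->
  exists m1 m2 : word * nat -> nat, [/\ rec (char_fun A) m1, rec (char_fun A) m2 &
    forall p, omap Posz (f p) =
      pdiff (pmax (fun t => m1 (p, t))) (pmax (fun t => m2 (p, t)))].
Proof.
move=> /recursive_search[r [hr rf _]].
(* 0 means that there is no answer yet, so the actual guess is [(v x s).-1]. *)
pose r' xn := if r xn is Some y then y.+1 else 0.
have hr' : rec (char_fun A') r'.
  by apply: (rec_oapp 0 (f := fun z => z.2.+1)); rec_tac.
have [e he lim] := jump_limit jump hr'.
pose N x s := first (fun k => e ((x, k), s) != 0) s.
pose v x s := e ((x, N x s), s).
(* A null guess counts as a revision, so that a search which never finds an accepted length keeps
   the counter growing. *)
pose event x s := [|| v x s == 0, N x s.+1 != N x s | v x s.+1 != v x s].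
pose m2 x s := \sum_(i < s) (if event x i then (v x i).-1.+1 else 0).
have hN Z (cZ : code Z) (x : Z -> word) (s : Z -> nat) : rec (char_fun A) x ->
    rec (char_fun A) s -> rec (char_fun A) (fun z => N (x z) (s z)).
  move=> hx hs; apply: (rec_iter (y := fun=> 0) (f := fun z =>
    if e ((x z.1, z.2), s z.1) != 0 then z.2 else z.2.+1)); rec_tac.
have hv Z (cZ : code Z) (x : Z -> word) (s : Z -> nat) : rec (char_fun A) x ->
    rec (char_fun A) s -> rec (char_fun A) (fun z => v (x z) (s z)).
  by move=> hx hs; rewrite /v; rec_tac; apply: hN.
have hm2 : rec (char_fun A) (fun z => m2 z.1 z.2).
  apply: (rec_sum (f := fun z => if event z.1.1 z.2 then (v z.1.1 z.2).-1.+1 else 0)); rec_tac.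
    by rewrite /event; rec_tac; first [apply: hv | apply: hN]; rec_tac.
  by apply: hv; rec_tac.
exists (fun z => m2 z.1 z.2 + (v z.1 z.2).-1), (fun z => m2 z.1 z.2); split=> //.
  by rec_tac; apply: hv; rec_tac.
move=> x /=.
have m2S s : m2 x s.+1 = m2 x s + (if event x s then (v x s).-1.+1 else 0).
  by rewrite /m2 big_ord_recr.
have mono (h : nat -> nat) : (forall s, h s <= h s.+1) -> forall t u, t <= u -> h t <= h u.
  move=> hS t u /subnK <-; elim: (u - t) => // k IH.
  by rewrite addSn; apply: leq_trans IH (hS _).
have m2_mono := mono _ (fun s => leq_trans (leq_addr _ _) (eq_leq (esym (m2S s)))).
have m1_mono : forall t u, t <= u -> m2 x t + (v x t).-1 <= m2 x u + (v x u).-1.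
  apply: (mono (fun s => m2 x s + (v x s).-1)) => s; rewrite m2S.
  by case E: (event x s); [lia|move: E; rewrite /event => /negbT; rewrite !negb_or; lia].
case fx: (f x) => [y|] /=.
  have : exists n, isSome (r (x, n)) by have [n rn] := (rf _ _).1 fx; exists n; rewrite rn.
  move=> /ex_minnP[T rT Tmin].
  have r'T : r' (x, T) = y.+1.
    rewrite /r'; case E: (r _) rT => [z|] // _; congr _.+1.
    by have := (rf x z).2 (ex_intro _ _ E); rewrite fx => -[].
  have r'j j : j < T -> r' (x, j) = 0.
    rewrite /r'; case E: (r _) => [z|] // jT.
    by have := Tmin j; rewrite E => /(_ isT); rewrite leqNgt jT.
  (* A common stage for the finitely many lengths up to the true first one; afterwards neither the
     length nor the guess can change. *)
  have [s0 hs] : exists s0, forall s, s0 <= s -> forall j, j <= T -> e ((x, j), s) = r' (x, j).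
    elim: (T) => [|k [s1 IH]].
      by have [s0 hs] := lim (x, 0); exists s0 => s /hs ? j; rewrite leqn0 => /eqP->.
    have [s0 hs] := lim (x, k.+1); exists (maxn s0 s1) => s; rewrite geq_max => /andP[/hs h0 /IH h1] j.
    by rewrite leq_eqVlt => /orP[/eqP->//|]; apply: h1.
  have NT s : maxn s0 T.+1 <= s -> N x s = T.
    rewrite geq_max => /andP[ss Ts].
    have [h1 h2 h3] := firstP (fun k => e ((x, k), s) != 0) s.
    apply/eqP; rewrite eqn_leq; apply/andP; split.
      rewrite leqNgt; apply/negP => /h2; rewrite hs //.
      by rewrite r'T.
    rewrite leqNgt; apply/negP => NT; have /h3 : N x s < s by apply: ltn_trans NT Ts.
    by rewrite -/(N x s) hs ?(ltnW NT) // r'j.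
  have vT s : maxn s0 T.+1 <= s -> v x s = y.+1.
    by move=> ss; rewrite /v NT // hs // (leq_trans (leq_maxl _ _) ss).
  have m2T s : maxn s0 T.+1 <= s -> m2 x s = m2 x (maxn s0 T.+1).
    move=> /subnK <-; elim: (s - _) => // k IH; rewrite addSn m2S IH.
    by rewrite /event !vT ?NT ?leqW ?leq_addl // !eqxx addn0.
  rewrite (pmax_mono m2_mono m2T).
  rewrite (pmax_mono m1_mono (m := m2 x (maxn s0 T.+1) + y) (s := maxn s0 T.+1)) /=.
    by congr Some; lia.
  by move=> t ht; rewrite m2T // vT.
suff -> : pmax (fun t => m2 x t) = None by case: (pmax _).
(* If [m2] had a maximum, reached at [s0], there would be no revision from then on: the length and a
   nonzero guess would be frozen, and in the limit this length would yield a value of [f x]. *)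
apply: option_ext => M; split=> // /pmaxP[[s0 hs0] hM]; exfalso.
have hc s : s0 <= s -> event x s = false.
  move=> ss; apply/negP => ev; have := hM s.+1; rewrite m2S ev.
  have := m2_mono _ _ ss; rewrite hs0; lia.
have NvE s : s0 <= s -> N x s = N x s0 /\ v x s = v x s0.
  move=> /subnK <-; elim: (s - s0) => // k [IH1 IH2].
  have := hc (k + s0) (leq_addl _ _); rewrite /event addSn => /negbT.
  by rewrite !negb_or !negbK => /and3P[_ /eqP-> /eqP->].
have v0 : v x s0 <> 0 by have := hc s0 (leqnn _); rewrite /event; case: eqP.
have [s1 hs1] := lim (x, N x s0).
have := hs1 (maxn s0 s1) (leq_maxr _ _).
have [<- vE] := NvE (maxn s0 s1) (leq_maxl _ _); rewrite -/(v x _) vE.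
rewrite /r'; case E: (r _) => [y|] // _.
by have := (rf x y).2 (ex_intro _ _ E); rewrite fx.
Qed.

Lemma diff_partial (f : pfun word nat) (h1 h2 : word * nat -> nat) :
  rec (char_fun A) h1 -> rec (char_fun A) h2 ->
  (forall p, omap Posz (f p) =
      pdiff (pmax (fun t => h1 (p, t))) (pmax (fun t => h2 (p, t)))) ->
  partial_recursive_in A' f.
Proof.
move=> /search_pmax[r1 hr1 rP1] /search_pmax[r2 hr2 rP2] fE.
have [d dK rd] := npair_surj.
(* Truncated subtraction is exact here: where both maxima exist, their difference in Z is a value of
   [f], hence nonnegative. *)
pose r (z : word * nat) := if r1 (z.1, (d z.2).1) is Some a then
  (if r2 (z.1, (d z.2).2) is Some b then Some (a - b) else None) else None.
have hd : rec (char_fun A') (fun z : word * nat => d z.2) by apply: (rec_comp (rd _)); rec_tac.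
apply: (search_recursive (r := r)).
  apply: (rec_oapp 0 (f := fun za => if r2 (za.1.1, (d za.1.2).2) is Some b
     then Some (za.2 - b) else None)); rec_tac.
  apply: (rec_oapp 0 (f := fun zb => Some (zb.1.2 - zb.2))); rec_tac.
  exact: (rec_comp hd rec_fst1).
move=> p y; have := fE p; rewrite /r; split.
  move=> fy; move: H; rewrite fy /=.
  case E1: (pmax _) => [a|] //; case E2: (pmax _) => [b|] //= [ab].
  have [n hn] := (rP1 _ _).1 E1; have [m hm] := (rP2 _ _).1 E2.
  by exists (npair (n, m)); rewrite /= dK /= hn hm; congr Some; lia.
case=> n /=; case E1: (r1 _) => [a|] //; case E2: (r2 _) => [b|] // [<-].
move: H; have -> := (rP1 p a).2 (ex_intro _ _ E1).
have -> := (rP2 p b).2 (ex_intro _ _ E2).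
by case: (f p) => [z|] //= [zE]; congr Some; lia.
Qed.
End Differences.

(** * Iterators *)

Definition succ_fun : pfun nat nat := fun n => Some n.+1.

Lemma iterate_succ n x : iterate n succ_fun x = Some (n + x).
Proof. by elim: n x => //= n IH x; rewrite IH addnS. Qed.

Lemma iterateE n g x : iterate n g x = iter n (obind g) (Some x).
Proof.
elim: n x => // n IH x; rewrite iterSr /=.
by case: (g x) => [y|] /=; [apply: IH|rewrite iter_None].
Qed.

Lemma ChurchP Psi n : Church Psi = Some n <-> forall g x, Psi g x = iterate n g x.
Proof.
apply: the_natP => i j hi hj.
have := hi succ_fun 0; rewrite hj !iterate_succ !addn0.
by case.
Qed.

Section Iterator.
Variables (r : word * nat * nat -> option nat) (N : pfun (word * nat) nat).
Hypotheses (hr : rec (char_fun set0) r) (rN : searches r N).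

(** The exponent is computed anew at each argument [x]; a single [x] where [N] is undefined keeps
    [Phi p] from being an iterator. *)
Let Phi p g x := obind (fun n => iterate n g x) (N (p, x)).

Let loop a := While a.+1 is_bit (Seq (Pop a.+1) (Seq (copy a.+3 a.+2 0)
  (Seq Ask (copy a.+3 0 a.+2)))).

Let wp_ask g a r0 (x y : nat) : r0 a.+2 = unary x -> g x = Some y ->
  wp g (Seq (copy a.+3 a.+2 0) (Seq Ask (copy a.+3 0 a.+2)))
    (fun r1 => r1 a.+2 = unary y /\ r1 a.+1 = r0 a.+1) r0.
Proof.
move=> rx gx; apply: wp_seq; apply: wp_mono (wp_copy _ _ _) _; first by rewrite /= !inE; lia.
move=> r1 [r1a s1]; apply: wp_seq; eexists.
  apply: (EAsk (m := y)); rewrite r1a rx (_ : lead _ = x) //.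
  by elim: (x) => //= k ->.
apply: wp_mono (wp_copy _ _ _) _; first by rewrite /= !inE; lia.
by move=> r2 [r2a s2]; split; rewrite ?r2a ?updE // s2 ?inE ?updN ?s1 ?inE //; lia.
Qed.

Let exec_ask g a r0 r1 (x : nat) : r0 a.+2 = unary x ->
  exec g (Seq (copy a.+3 a.+2 0) (Seq Ask (copy a.+3 0 a.+2))) r0 r1 -> exists y, g x = Some y.
Proof.
move=> rx E; inversion E as [| | | |? ? ? r2 ? E1 E2| | | |]; subst.
inversion E2 as [| | | |? ? ? r3 ? E3 _| | | |]; subst.
have u : uniq [:: a.+3; a.+2; 0] by rewrite /= !inE; lia.
have [r2a _] := wp_exec (wp_copy g _ u) E1.
inversion E3 as [| | |? m gm| | | | |]; subst; exists m.
rewrite -gm r2a rx (_ : lead _ = x) //.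
by elim: (x) => //= k ->.
Qed.

Let wp_loop g a n x y r0 : r0 a.+1 = unary n -> r0 a.+2 = unary x ->
  iterate n g x = Some y -> wp g (loop a) (fun r1 => r1 a.+2 = unary y) r0.
Proof.
elim: n x r0 => [|n IH] x r0 rn rx /=; first by case=> <-; apply: wp_while; rewrite rn.
case gx: (g x) => [z|] //= iz; apply: wp_while; rewrite rn /=.
apply: wp_seq; apply: wp_pop.
apply: wp_mono (wp_ask _ gx) _; first by rewrite updN ?rx //; lia.
by move=> r1 [r1z r1n]; apply: (IH z) => //; rewrite r1n updE rn.
Qed.

Let exec_loop g a n x r0 r1 : r0 a.+1 = unary n -> r0 a.+2 = unary x ->
  exec g (loop a) r0 r1 -> iterate n g x <> None.
Proof.
elim: n x r0 => [//|n IH] x r0 rn rx E /=.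
inversion E as [| | | | | | |? ? ? ? r2 ? _ E1 E2|? ? ? ? E1]; subst; last by rewrite rn in E1.
inversion E1 as [| | | |? ? ? r3 ? E3 E4| | | |]; subst.
inversion E3; subst.
have ux : upd r0 a.+1 (behead (r0 a.+1)) a.+2 = unary x by rewrite updN ?rx //; lia.
have [y gx] := exec_ask ux E4; rewrite gx /=.
have [r2y r2n] := wp_exec (wp_ask ux gx) E4.
by apply: IH E2 => //; rewrite r2n updE rn.
Qed.

Lemma computable_iterator : computable_functional Phi.
Proof.
(* The search for the exponent runs with an arbitrary partial oracle, where a query could block it
   or receive another answer than 0. *)
have [e he] := hr; pose e' a := strip (e a).
have he' g : transforms g e' (fun x => enc x) (fun x => enc (r x)) by apply: transforms_strip.
pose prep a := Seq (copy a.+2 a a.+1) (Seq (search_cmd e' a.+1) (Seq (copy a.+3 a a.+2)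
  (Seq (unpair a.+2 a.+3) (Pop a.+2)))).
have wp_prep g a r0 p x n : 0 < a -> r0 a = enc (p, x) -> N (p, x) = Some n ->
    wp g (prep a) (fun r1 => r1 a.+1 = unary n /\ r1 a.+2 = unary x) r0.
  move=> a0 r0a Nn; have /rN[k rk] := Nn.
  apply: wp_seq; apply: wp_mono (wp_copy _ _ _) _; first by rewrite /= !inE; lia.
  move=> r1 [r1a s1]; apply: wp_seq.
  apply: wp_mono (wp_search (he' g) _ _ rk _) _ => //; first by rewrite r1a.
    move=> m z rz; have : N (p, x) = Some z by apply/rN; exists m.
    by rewrite Nn => -[].
  move=> r2 [r2a s2]; apply: wp_seq.
  apply: wp_mono (wp_copy _ _ _) _; first by rewrite /= !inE; lia.
  move=> r3 [r3a s3].
  apply: wp_mono (@transforms_snd g (word * nat) (fun z => enc z) a.+2 isT r3 (p, x) _) _.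
    by rewrite r3a s2 ?s1 // ?inE; lia.
  move=> r4 [r4a s4]; split; last by rewrite r4a /= sndwK.
  by rewrite s4 ?s3 ?inE ?r2a //; lia.
have exec_prep g a r0 r1 p x : 0 < a -> r0 a = enc (p, x) -> exec g (prep a) r0 r1 ->
    exists n, N (p, x) = Some n.
  move=> a0 r0a E; inversion E as [| | | |? ? ? r2 ? E1 E2| | | |]; subst.
  inversion E2 as [| | | |? ? ? r3 ? E3 _| | | |]; subst.
  have u : uniq [:: a.+2; a; a.+1] by rewrite /= !inE; lia.
  have [r2a _] := wp_exec (wp_copy g _ u) E1.
  have r2x : r2 a.+1 = enc (p, x) by rewrite r2a.
  have [n] := exec_search (he' g) (isT : 0 < a.+1) r2x E3.
  case E4: (r _) => [z|] // _; exists z; apply/rN; by exists n.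
have [|M hM] := @program_outputs _ _ _ _ _ _ _ _ setT
  (fun a => Seq (prep a) (Seq (loop a) (copy a.+3 a.+2 a))) (fun g z => Phi z.1 g z.2); last first.
  by exists M => p g x y; apply: (hM g I (p, x)).
move=> g a r0 [p x] _ a0 r0a; rewrite /Phi /=; split.
  move=> y; case Nn: (N _) => [n|] //= iy.
  apply: wp_seq; apply: wp_mono (wp_prep _ _ _ _ _ _ a0 r0a Nn) _ => r1 [r1n r1x].
  apply: wp_seq; apply: wp_mono (wp_loop r1n r1x iy) _ => r2 r2y.
  apply: wp_mono (wp_copy _ _ _) _; first by rewrite /= !inE; lia.
  by move=> r3 [-> _].
move=> r' E; inversion E as [| | | |? ? ? r2 ? E1 E2| | | |]; subst.
have [n Nn] := exec_prep _ _ _ _ _ _ a0 r0a E1; rewrite Nn /=.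
have [r2n r2x] := wp_exec (wp_prep _ _ _ _ _ _ a0 r0a Nn) E1.
inversion E2 as [| | | |? ? ? r3 ? E3 _| | | |]; subst.
exact: exec_loop r2n r2x E3.
Qed.
End Iterator.

Lemma Church_of_restriction (F : pfun word nat) (P : set word) :
  partial_recursive F -> Pi02 P -> exists2 Phi : word -> functional,
    computable_functional Phi & forall p, prestrict F P p = Church (Phi p).
Proof.
move=> /recursive_search[r [hr rF rm]] [R /total_recursive_rec hR PR].
pose N : pfun (word * nat) nat := fun z =>
  if `[< forall m, m <= z.2 -> exists n, R (z.1, m, n) = 1 >] then F z.1 else None.
pose q (z : word * nat * nat) := if all (fun m => has (fun k => R (z.1.1, m, k) == 1)
  (iota 0 z.2)) (iota 0 (z.1.2 + 1)) then r (z.1.1, z.2) else None.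
have hq : rec (char_fun set0) q.
  rewrite /q; rec_tac.
  apply: (rec_all (f := fun zm => has (fun k => R (zm.1.1.1, zm.2, k) == 1)
    (iota 0 zm.1.2))); rec_tac.
  by apply: (rec_has (f := fun z => R (z.1.1.1.1, z.1.2, z.2) == 1)); rec_tac.
have qN : searches q N.
  move=> [p x] y; rewrite /N /q /=; split.
    case: asboolP => // h /rF[n rn].
    have [s hs] : exists s, all (fun m => has (fun k => R (p, m, k) == 1) (iota 0 s)) (iota 0 (x + 1)).
      elim: x h => [|x IH] h.
        have [k Rk] := h 0 (leqnn 0); exists k.+1; apply/allP => m.
        rewrite mem_iota => m0; have -> : m = 0 by lia.
        by apply/hasP; exists k; rewrite ?Rk // mem_iota /=; lia.
      have [s /allP hs] := IH (fun m mx => h m (leqW mx)).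
      have [k Rk] := h x.+1 (leqnn _); exists (maxn s k.+1); apply/allP => m.
      rewrite mem_iota /= add0n addn1 ltnS leq_eqVlt => /orP[/eqP->|mx].
        by apply/hasP; exists k; rewrite ?Rk // mem_iota /=; lia.
      have /hs/hasP[j js Rj] : m \in iota 0 (x + 1) by rewrite mem_iota /=; lia.
      by apply/hasP; exists j => //; move: js; rewrite !mem_iota /=; lia.
    exists (maxn n s); rewrite (_ : all _ _).
      exact: rm _ _ _ _ rn (leq_maxl _ _).
    move: hs; apply: sub_all => m /hasP[k ks Rk]; apply/hasP; exists k => //.
    by move: ks; rewrite !mem_iota /=; lia.
  case=> n; case: ifP => // /allP h rn; rewrite asboolT; first by apply/rF; exists n.
  move=> m mx; have /h/hasP[k _ /eqP Rk] : m \in iota 0 (x + 1) by rewrite mem_iota /=; lia.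
  by exists k.
exists (fun p g x => obind (fun n => iterate n g x) (N (p, x))).
  exact: computable_iterator hq qN.
move=> p; apply: option_ext => n; rewrite ChurchP /prestrict; split.
  case: asboolP => // /PR hp Fp g x; by rewrite /N asboolT /= ?Fp.
(* An iterator maps the total [succ_fun] to a total function. So [N] is defined at every [x], which
   yields all instances of the Pi02 condition. *)
move=> h; have Nx x : exists k, N (p, x) = Some k.
  have := h succ_fun x; rewrite iterate_succ; case: (N _) => // k _.
  by exists k.
have Pp : P p.
  apply/PR => m; have [k] := Nx m; rewrite /N /=; case: asboolP => // hm _.
  exact: hm.
rewrite asboolT //; have [k] := Nx 0; move: (h succ_fun 0).
rewrite iterate_succ /N asboolT /=; last by move=> m _; apply: (PR p).1.
by case: (F p) => //= k'; rewrite iterate_succ !addn0 => -[->].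
Qed.

(** * Continuity of functionals and finite oracles *)

Section Continuity.
Variables (M : otm) (g : pfun nat nat).

Definition extends (b : nat) (g g' : pfun nat nat) :=
  forall i v, i < b -> g i = Some v -> g' i = Some v.

Lemma extends_leq b c g' : extends c g g' -> b <= c -> extends b g g'.
Proof. by move=> h bc i v ib; apply: h; apply: leq_trans bc. Qed.

Lemma outputs_continuous `{iX : input X, oY : output Y} (x : X) (y : Y) :
  outputs M g x y -> exists b, forall g', extends b g g' -> outputs M g' x y.
Proof.
move=> [t [c [hc hh hy]]].
have [b hb] : exists b, forall g', extends b g g' ->
    iter t (obind (step g')) (Some (init M (load x))) = Some c; last first.
  by exists b => g' /hb hg; exists t, c.
elim: t c hc {hh hy} => [|t IH] c; first by move=> hc; exists 0.
rewrite iterS; case E: (iter t _ _) => [c'|] //= hc'.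
have [b hb] := IH _ E; exists (maxn b (read_nat (c'.2 (query_tape M))).+1) => g' hg.
rewrite hb /=; last by apply: extends_leq hg _; apply: leq_maxl.
move: hc'; rewrite /step; case: (prog _) => //= q.
case gq: (g _) => [v|] //= <-.
by rewrite (hg _ v _ gq) // leq_maxr.
Qed.

Lemma iterate_continuous n x y : iterate n g x = Some y ->
  exists b, forall g', extends b g g' -> iterate n g' x = Some y.
Proof.
elim: n x => [|n IH] x /=; first by exists 0.
case gx: (g x) => [z|] //= /IH[b hb]; exists (maxn b x.+1) => g' hg.
rewrite (hg x z) /= ?leq_maxr //; apply: hb.
by apply: extends_leq hg _; apply: leq_maxl.
Qed.
End Continuity.

(* A word codes a sequence of numbers, ending with zeros; the number [v.+1] at
   position [i] means that the finite function maps [i] to [v]. *)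
Definition table (c : word) : pfun nat nat :=
  fun i => if size (fstw (iter i sndw c)) is v.+1 then Some v else None.

(** By the first property a computation with oracle [g] passes to the table; by the second its
    result returns to [g]. *)
Lemma table_approx (g : pfun nat nat) b : exists c,
  extends b g (table c) /\ forall i v, table c i = Some v -> g i = Some v.
Proof.
elim: b g => [|b IH] g.
  exists [::]; split=> // i v; rewrite /table.
  by have -> : iter i sndw [::] = [::] by elim: i => //= i ->.
have [c [h1 h2]] := IH (fun i => g i.+1).
exists (pairw (if g 0 is Some v then unary v.+1 else [::]) c).
have t0 : table (pairw (if g 0 is Some v then unary v.+1 else [::]) c) 0 = g 0.
  by rewrite /table /= fstwK; case: (g 0) => //= v; rewrite size_nseq.
have tS i : table (pairw (if g 0 is Some v then unary v.+1 else [::]) c) i.+1 = table c i.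
  by rewrite /table iterSr sndwK.
split=> [[|i] v|[|i] v]; rewrite ?t0 ?tS //; first exact: h1.
exact: h2.
Qed.

Lemma rec_table `{cX : code X} h (c : X -> word) (i : X -> nat) : rec h c -> rec h i ->
  rec h (fun x => table (c x) (i x)).
Proof.
move=> hc hi.
have hn : rec h (fun x => size (fstw (iter (i x) sndw (c x)))).
  apply: rec_size; apply: (rec_fstw (h := fun x => iter (i x) sndw (c x))) => //.
  apply: (rec_iter (f := fun z => sndw z.2)) => //.
  by apply: (rec_sndw (h := fun z : X * word => z.2)) => //; rec_tac.
apply: rec_ext (rec_if (rec_lt0n hn) (rec_some (rec_pred hn)) (rec_const None)) _ => x.
by rewrite /table; case: (size _).
Qed.

Definition wrun (M : otm) (g : pfun nat nat) (p : word) (x t : nat) : option nat :=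
  run M g (p, x) t.

Lemma restriction_of_Church (Phi : word -> functional) : computable_functional Phi ->
  exists (F : pfun word nat) (P : set word),
    [/\ partial_recursive F, Pi02 P & forall p, Church (Phi p) = prestrict F P p].
Proof.
move=> [M hM].
pose P p := exists n, forall g x, Phi p g x = iterate n g x.
pose F p := Phi p succ_fun 0.
pose rF p s := wrun M succ_fun p 0 s.
have rFP p y : F p = Some y <-> exists s, rF p s = Some y by rewrite /F hM runP.
have hrF g Z (cZ : code Z) (p : Z -> word) (s : Z -> nat) : rec g p -> rec g s ->
    rec g (fun z => rF (p z) (s z)).
  by move=> hp hs; apply: (rec_run M (o := fun zn => Some zn.2.+1)); rec_tac.
exists F, P; split.
- apply: (search_recursive (r := fun z => rF z.1 z.2)); last by move=> p y; apply: rFP.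
  by apply: hrF; rec_tac.
- have [d dK rd] := @ofnat_ex (word * (nat * nat)) _ _.
  pose rG p c x t := wrun M (table c) p x t.
  have hrG g Z (cZ : code Z) (p c : Z -> word) (x t : Z -> nat) : rec g p -> rec g c ->
      rec g x -> rec g t -> rec g (fun z => rG (p z) (c z) (x z) (t z)).
    move=> hp hc hx ht; apply: (rec_run M (o := fun zn => table (c zn.1) zn.2)); rec_tac.
    by apply: rec_table; rec_tac.
  (* Halting is a premise with the bound [t], quantified universally, and a conclusion with the
     bound [s], quantified existentially: this is what keeps the condition Pi02. *)
  pose check p n c x t s := let u := iterate n (table c) x in
    (isSome u || isSome (rG p c x t)) ==> (isSome u && (rG p c x s == u)).
  (* [z.1.2] codes the table, the argument and the bound [t]. The existential variable [z.2] also
     bounds the computation of [F p], so that any instance forces [F p] to be defined and provides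
     the candidate exponent. *)
  pose R (z : word * nat * nat) : nat := if rF z.1.1 z.2 is Some n then
    check z.1.1 n (d z.1.2).1 (d z.1.2).2.1 (d z.1.2).2.2 z.2 else false.
  exists R.
    apply: rec_total_recursive.
    have hd := rd (char_fun set0).
    have hu : rec (char_fun set0) (fun z : word * nat * nat * nat =>
        iterate z.2 (table (d z.1.1.2).1) (d z.1.1.2).2.1).
      apply: rec_ext (rec_iter (n := fun z : word * nat * nat * nat => z.2)
        (y := fun z => Some (d z.1.1.2).2.1)
        (f := fun z => if z.2 is Some x then table (d (z, x).1.1.1.1.2).1 (z, x).2 else None)
        rec_snd1 _ _) _.
      + by rec_tac.
      + apply: (rec_oapp 0 (f := fun w : (word * nat * nat * nat * option nat) * nat =>
          table (d w.1.1.1.1.2).1 w.2)); rec_tac; apply: rec_table; rec_tac.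
      + by move=> z; rewrite iterateE.
    apply: rec_ext (rec_nat_of_bool (rec_oapp 0 (f := fun z : word * nat * nat * nat =>
      check z.1.1.1 z.2 (d z.1.1.2).1 (d z.1.1.2).2.1 (d z.1.1.2).2.2 z.1.2)
      (h := fun z => rF z.1.1 z.2) (d := fun=> false) _ _ _)) _.
    + by apply: hrF; rec_tac.
    + rewrite /check; rec_tac; try (apply: hrG; rec_tac).
      by apply: rec_eq => //; apply: hrG; rec_tac.
    + exact: rec_const.
    + by move=> z; rewrite /R; case: (rF _ _).
  move=> p; split=> [[n hn] m|h].
    have /rFP[s0 hs0] : F p = Some n by rewrite /F hn iterate_succ addn0.
    rewrite /R /check /=; case: (d m) => [c [x t]] /=.
    case Eu: (iterate n (table c) x) => [y|].
      have /hM/runP[s1 hs1] : Phi p (table c) x = Some y by rewrite hn.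
      exists (maxn s0 s1).
      have -> : rF p (maxn s0 s1) = Some n by apply: run_mono hs0 _; apply: leq_maxl.
      have -> : rG p c x (maxn s0 s1) = Some y by apply: run_mono hs1 _; apply: leq_maxr.
      by rewrite Eu /= eqxx.
    exists s0; rewrite hs0 Eu /=; case Et: (rG p c x t) => [y|] //.
    have /hM : outputs M (table c) (p, x) y by apply/runP; exists t.
    by rewrite hn Eu.
  have [n Fn] : exists n, F p = Some n.
    have [s] := h 0; rewrite /R /=; case E: (rF p s) => [n|] // _.
    by exists n; apply/rFP; exists s.
  have key c x t : isSome (iterate n (table c) x) || isSome (rG p c x t) ->
      exists y s, iterate n (table c) x = Some y /\ rG p c x s = Some y.
    move=> hd; have [s] := h (tonat (c, (x, t))); rewrite /R /= dK /=.
    case E: (rF p s) => [n'|] //.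
    have : F p = Some n' by apply/rFP; exists s.
    rewrite Fn => -[<-]; rewrite /check hd /=.
    case: (iterate n _ _) => [y|] //= hy.
    by exists y, s; split=> //; apply/eqP; case: (_ == _) hy.
  (* A value of either side at [g] is already obtained with a finite table below [g]. There [key]
     makes both sides agree, and the common value returns to [g] because [g] extends the table. *)
  exists n => g x; apply: option_ext => y; split.
    move=> /hM hy0; have [b hb] := outputs_continuous hy0; have [c [gc cg]] := table_approx g b.
    have hy := hb _ gc; have /runP[t ht] := hy.
    have [|y' [s [uy' ry']]] := key c x t; first by rewrite /rG /wrun ht orbT.
    have yy' : y = y'.
      by apply: outputs_fun hy _; apply/runP; exists s.
    have [b' hb'] := iterate_continuous uy'; rewrite yy'; apply: hb'.
    by move=> i v _; apply: cg.
  move=> /[dup] iy /iterate_continuous[b hb]; have [c [gc cg]] := table_approx g b.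
  have uy := hb _ gc; have [|y' [s [uy' ry']]] := key c x 0; first by rewrite uy.
  have hy' : outputs M (table c) (p, x) y' by apply/runP; exists s.
  have [b' hb'] := outputs_continuous hy'; apply/hM.
  have -> : y = y' by move: uy'; rewrite uy => -[].
  by apply: hb' => i v _; apply: cg.
- move=> p; apply: option_ext => n; rewrite ChurchP /prestrict; split.
    move=> h; rewrite asboolT; last by exists n.
    by rewrite /F h iterate_succ addn0.
  case: asboolP => // -[m hm]; rewrite /F hm iterate_succ addn0 => -[<-].
  exact: hm.
Qed.

Theorem theorem1p7
    (UN : pfun (word * nat) nat) (hUN : acceptable set0 UN)
    (UNN : pfun (word * (nat * nat)) nat) (hUNN : acceptable set0 UNN)
    (J1 : set nat) (hJ1 : is_jump set0 J1)
    (J2 : set nat) (hJ2 : is_jump J1 J2)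
    (f : pfun word nat) :
  ((exists (F : pfun word nat) (P : set word),
      [/\ partial_recursive F, Pi02 P & forall p, f p = prestrict F P p]) <->
   (exists2 Phi : word -> functional, computable_functional Phi &
      forall p, f p = Church (Phi p)))
  /\
  (max_of_recursive_in set0 f <->
   (exists2 phi : word -> word, total_recursive phi &
      forall p, f p = pcard (W UN (phi p))))
  /\
  ((max_of_recursive_in J1 f ->
    exists2 phi : word -> word, total_recursive phi &
      forall p, omap succn (f p) = pindex (W UNN (phi p)))
   /\
   ((exists2 phi : word -> word, total_recursive phi &
       forall p, f p = pindex (W UNN (phi p))) ->
    max_of_recursive_in J1 f))
  /\
  ((partial_recursive_in J1 f <->
    exists phi1 phi2 : word -> word,
      [/\ total_recursive phi1, total_recursive phi2 &
          forall p, omap Posz (f p) =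
            pdiff (pcard (W UN (phi1 p))) (pcard (W UN (phi2 p)))])
   /\
   (partial_recursive_in J2 f <->
    exists phi1 phi2 : word -> word,
      [/\ total_recursive phi1, total_recursive phi2 &
          forall p, omap Posz (f p) =
            pdiff (pindex (W UNN (phi1 p))) (pindex (W UNN (phi2 p)))])).
Proof.
(* The shifts by 1 from [index_of_max] cancel in a difference of indices. *)
have pdiffS a b : pdiff (omap succn a) (omap succn b) = pdiff a b.
  by case: a b => [a|] [b|] //=; congr Some; lia.
split; [|split; [|split; [split|split]]].
- split=> [[F [P [hF hP fE]]]|[Phi hPhi fE]].
    have [Phi hPhi PhiE] := Church_of_restriction hF hP.
    by exists Phi => // p; rewrite fE PhiE.
  have [F [P [hF hP PhiE]]] := restriction_of_Church hPhi.
  by exists F, P; split=> // p; rewrite fE PhiE.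
- split=> [[h /total_recursive_rec hh fE]|[phi hphi fE]].
    have [phi hphi phiE] := card_of_max hUN hh.
    by exists phi => // p; rewrite fE phiE.
  have [h hh hE] := max_of_card hUN hphi.
  by exists h => [|p]; [apply: rec_total_recursive|rewrite fE hE].
- move=> [h /total_recursive_rec hh fE].
  have [phi hphi phiE] := index_of_max hUNN hJ1 hh.
  by exists phi => // p; rewrite fE phiE.
- move=> [phi hphi fE]; have [h hh hE] := max_of_index hUNN hJ1 hphi.
  by exists h => [|p]; [apply: rec_total_recursive|rewrite fE hE].
- split=> [/(partial_diff hJ1)[m1 [m2 [hm1 hm2 fE]]]|[phi1 [phi2 [h1 h2 fE]]]].
    have [phi1 hphi1 E1] := card_of_max hUN hm1.
    have [phi2 hphi2 E2] := card_of_max hUN hm2.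
    by exists phi1, phi2; split=> // p; rewrite fE E1 E2.
  have [m1 hm1 E1] := max_of_card hUN h1; have [m2 hm2 E2] := max_of_card hUN h2.
  by apply: (diff_partial hJ1 hm1 hm2) => p; rewrite fE E1 E2.
- split=> [/(partial_diff hJ2)[m1 [m2 [hm1 hm2 fE]]]|[phi1 [phi2 [h1 h2 fE]]]].
    have [phi1 hphi1 E1] := index_of_max hUNN hJ1 hm1.
    have [phi2 hphi2 E2] := index_of_max hUNN hJ1 hm2.
    by exists phi1, phi2; split=> // p; rewrite fE E1 E2 pdiffS.
  have [m1 hm1 E1] := max_of_index hUNN hJ1 h1.
  have [m2 hm2 E2] := max_of_index hUNN hJ1 h2.
  by apply: (diff_partial hJ2 hm1 hm2) => p; rewrite fE E1 E2.
Qed.
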